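(* Let $K$ be a field, let $\Gamma$ be the quiver with vertices $1,2,3,4$ and arrows $\delta\colon 3\to 1$, $\alpha\colon 1\to 2$, $\beta\colon 1\to 2$, $\gamma\colon 2\to 1$, $\epsilon\colon 2\to 4$, and let $R=K\Gamma/I$, where the ideal $I$ is generated by $\epsilon\beta$, $\gamma\beta$, $\beta\delta$, $\epsilon\alpha\delta$, all paths leaving the vertex $1$ that have length at least $3$, and all paths leaving the vertex $2$ that have length at least $2$. Then the cotorsion pair $(\mathcal{P}_2(R\text{-}\mathrm{Mod}),\mathcal{P}_2(R\text{-}\mathrm{Mod})^{\perp})$ is of finite type, but the cotorsion pair $(\mathcal{P}_1(R\text{-}\mathrm{Mod}),\mathcal{P}_1(R\text{-}\mathrm{Mod})^{\perp})$ is not of finite type.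
   Context: Paths are composed from right to left: e.g. $\gamma\beta$ is the path that first follows $\beta$ and then $\gamma$, and $\epsilon\alpha\delta$ first follows $\delta$, then $\alpha$, then $\epsilon$; $R$ is a finite dimensional $K$-algebra. All modules are left $R$-modules. $\mathcal{P}_n(R\text{-}\mathrm{Mod})$ is the class of left $R$-modules of projective dimension at most $n$. For a class $\mathcal{C}$ of left $R$-modules, $\mathcal{C}^{\perp}=\{X : \mathrm{Ext}_R^i(C,X)=0 \text{ for all } C\in\mathcal{C},\ i\ge 1\}$, ${}^{\perp}\mathcal{C}=\{X : \mathrm{Ext}_R^i(X,C)=0 \text{ for all } C\in\mathcal{C},\ i\ge 1\}$. A hereditary cotorsion pair is a pair $(\mathcal{A},\mathcal{B})$ with $\mathcal{A}={}^{\perp}\mathcal{B}$, $\mathcal{B}=\mathcal{A}^{\perp}$; $(\mathcal{P}_n(R\text{-}\mathrm{Mod}),\mathcal{P}_n(R\text{-}\mathrm{Mod})^\perp)$ is one for every $n$. It is of finite type if there is a class $\mathcal{S}$ of modules having a projective resolution by finitely generated projective modules (for this $R$: finitely generated modules) such that $\mathcal{S}^{\perp}=\mathcal{B}$. *)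

(* Defs.v *)
From HB Require Import structures.
From mathcomp Require Import all_boot all_order all_algebra.
From mathcomp Require Import finmap.
From mathcomp Require Import boolp.
From mathcomp Require Import monalg.

Set Implicit Arguments.
Unset Strict Implicit.
Unset Printing Implicit Defensive.

Import GRing.Theory.
Local Open Scope ring_scope.

Record quiver := Quiver {
  vertex : finType;
  arrow  : finType;
  source : arrow -> vertex;
  target : arrow -> vertex
}.

Section Paths.
Variable Q : quiver.

(* [w = [:: a_n; ...; a_1]] stands for the word a_n ... a_1 read right to left,
   so a_1 (the last entry) is followed first; [word_end v w] is the vertex
   reached from v. *)
Definition word_end (v : vertex Q) (w : seq (arrow Q)) : vertex Q :=
  if w is a :: _ then target a else v.

Fixpoint is_qpath (v : vertex Q) (w : seq (arrow Q)) : bool :=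
  if w is a :: w' then (source a == word_end v w') && is_qpath v w' else true.

(* The starting vertex is recorded, so that there is one trivial path
   at each vertex. *)
Record qpath := QPath {
  path_val : vertex Q * seq (arrow Q);
  path_valid : is_qpath path_val.1 path_val.2
}.

HB.instance Definition _ := [isSub for path_val].
HB.instance Definition _ := [Choice of qpath by <:].

Definition path_source (p : qpath) : vertex Q := (path_val p).1.
Definition path_word (p : qpath) : seq (arrow Q) := (path_val p).2.
Definition path_target (p : qpath) : vertex Q :=
  word_end (path_source p) (path_word p).
Definition path_length (p : qpath) : nat := size (path_word p).

Definition trivial_path (v : vertex Q) : qpath :=
  @QPath (v, [::]) isT.

Lemma is_qpath1 (a : arrow Q) : is_qpath (source a) [:: a].
Proof. by rewrite /= eqxx. Qed.

Definition arrow_path (a : arrow Q) : qpath :=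
  @QPath (source a, [:: a]) (is_qpath1 a).

Lemma word_end_cat v (w w' : seq (arrow Q)) :
  word_end v (w ++ w') = word_end (word_end v w') w.
Proof. by case: w. Qed.

Lemma is_qpath_cat v (w w' : seq (arrow Q)) :
  is_qpath v (w ++ w') = is_qpath (word_end v w') w && is_qpath v w'.
Proof. by elim: w => //= a w ->; rewrite word_end_cat andbA. Qed.

(* "First q, then p"; [None] when q does not end where p starts. *)
Definition path_comp (p q : qpath) : option qpath :=
  if path_source p == path_target q
  then (insub (path_source q, path_word p ++ path_word q) : option qpath)
  else None.

Lemma qpath_eq (p q : qpath) :
  path_source p = path_source q -> path_word p = path_word q -> p = q.
Proof.
case: p q => [[u w] pw] [[v w'] qw]; rewrite /path_source /path_word /=.
by move=> uv ww'; apply: val_inj; rewrite /= uv ww'.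
Qed.

Lemma path_compP (p q : qpath) : path_source p = path_target q ->
  exists r, [/\ path_comp p q = Some r, path_source r = path_source q
    & path_word r = path_word p ++ path_word q].
Proof.
move=> pq; rewrite /path_comp pq eqxx.
case: insubP => [r _ vr|].
  by exists r; rewrite /path_source /path_word vr.
rewrite /= is_qpath_cat; move: pq (valP p) (valP q); rewrite /path_target => <-.
by rewrite /path_source /path_word => -> ->.
Qed.

Lemma path_comp_trivl v (q : qpath) :
  path_comp (trivial_path v) q = if v == path_target q then Some q else None.
Proof.
rewrite /path_comp /path_source /=; case: eqP => // _.
case: q => [[u w] qw]; exact: insubT.
Qed.

Lemma path_comp_trivr v (p : qpath) :
  path_comp p (trivial_path v) = if v == path_source p then Some p else None.
Proof.
rewrite /path_comp /path_target /= eq_sym; case: eqP => // ->.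
by case: p => [[u w] qw]; rewrite /path_word /= cats0; apply: insubT.
Qed.

Lemma path_compA (p q r : qpath) :
  obind (path_comp p) (path_comp q r) =
  obind (fun s => path_comp s r) (path_comp p q).
Proof.
have compN a b : path_source a != path_target b -> path_comp a b = None.
  by rewrite /path_comp => /negPf ->.
have [qr|qr] := eqVneq (path_source q) (path_target r); last first.
  rewrite (compN _ _ qr) /=.
  have [pq|/compN -> //] := eqVneq (path_source p) (path_target q).
  by have [s [-> /= ss _]] := path_compP pq; rewrite compN // ss.
have [s [-> /= ss sw]] := path_compP qr.
have st : path_target s = path_target q.
  by rewrite /path_target ss sw word_end_cat -[word_end _ (path_word r)]qr.
have [pq|pq] := eqVneq (path_source p) (path_target q); last first.
  by rewrite (compN _ _ pq) compN // st.
have [t [-> /= ts tw]] := path_compP pq.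
have [x [-> xs xw]] := path_compP (etrans pq (esym st)).
have [y [-> ys yw]] := path_compP (etrans ts qr).
by congr Some; apply: qpath_eq; rewrite ?xs ?ys ?ss // xw yw sw tw catA.
Qed.

End Paths.

(* The K-vector space with the paths of Q as basis. *)
Definition path_algebra (K : fieldType) (Q : quiver) := {malg K[qpath Q]}.

Definition path_elt (K : fieldType) (Q : quiver) (p : qpath Q) :
  path_algebra K Q := << p >>.

Definition scaled_path (K : fieldType) (Q : quiver) (c : K)
    (o : option (qpath Q)) : path_algebra K Q :=
  if o is Some p then << c *g p >> else 0.

HB.lock Definition pa_mul (K : fieldType) (Q : quiver)
    (f g : path_algebra K Q) : path_algebra K Q :=
  \sum_(p <- msupp f) \sum_(q <- msupp g)
    scaled_path (f@_p * g@_q) (path_comp p q).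

Section PathAlgebra.
Variables (K : fieldType) (Q : quiver).
Local Notation KQ := (path_algebra K Q).
Local Notation supp := (@msupp (qpath Q) K).
Local Notation scaled_path := (@scaled_path K Q).
Local Notation pa_mul := (@pa_mul K Q).

HB.instance Definition _ := GRing.Lmodule.on KQ.

Definition pa_one : KQ := \sum_(v : vertex Q) path_elt K (trivial_path v).

Lemma scaled_path0 o : scaled_path 0 o = 0.
Proof. by case: o => //= p; rewrite monalgU0. Qed.

Lemma scaled_pathD o c d :
  scaled_path (c + d) o = scaled_path c o + scaled_path d o.
Proof. by case: o => [p|] /=; rewrite ?monalgUD ?addr0. Qed.

Lemma pa_mulw (d1 d2 : {fset qpath Q}) (f g : KQ) :
  (supp f `<=` d1)%fset -> (supp g `<=` d2)%fset ->
  pa_mul f g = \sum_(p <- d1) \sum_(q <- d2)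
    scaled_path (f@_p * g@_q) (path_comp p q).
Proof.
move=> le1 le2; rewrite pa_mul.unlock (big_fset_incl _ le1) /=.
  apply/eq_bigr=> p _; apply/big_fset_incl => // q _ /mcoeff_outdom ->.
  by rewrite mulr0 scaled_path0.
move=> p _ /mcoeff_outdom fp; rewrite big1 // => q _.
by rewrite fp mul0r scaled_path0.
Qed.

Lemma pa_mulDl : left_distributive pa_mul +%R.
Proof.
move=> f1 f2 g.
rewrite (pa_mulw (fsubsetUl (supp f1) (supp f2)) (fsubset_refl _)).
rewrite (pa_mulw (fsubsetUr (supp f1) (supp f2)) (fsubset_refl _)).
rewrite (pa_mulw (msuppD_le _ _) (fsubset_refl _)).
rewrite -big_split; apply/eq_bigr => p _; rewrite -big_split.
by apply/eq_bigr => q _; rewrite mcoeffD mulrDl scaled_pathD.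
Qed.

Lemma pa_mulDr : right_distributive pa_mul +%R.
Proof.
move=> f g1 g2.
rewrite (pa_mulw (fsubset_refl _) (fsubsetUl (supp g1) (supp g2))).
rewrite (pa_mulw (fsubset_refl _) (fsubsetUr (supp g1) (supp g2))).
rewrite (pa_mulw (fsubset_refl _) (msuppD_le _ _)).
rewrite -big_split; apply/eq_bigr => p _; rewrite -big_split.
by apply/eq_bigr => q _; rewrite mcoeffD mulrDr scaled_pathD.
Qed.

Lemma pa_mul0g g : pa_mul 0 g = 0.
Proof. by rewrite pa_mul.unlock msupp0 big_seq_fset0. Qed.

Lemma pa_mulg0 f : pa_mul f 0 = 0.
Proof. by rewrite pa_mul.unlock msupp0 big1 // => p _; rewrite big_seq_fset0. Qed.

Lemma pa_mulUU c d p q :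
  pa_mul << c *g p >> << d *g q >> = scaled_path (c * d) (path_comp p q).
Proof. by rewrite (pa_mulw msuppU_le msuppU_le) !big_seq_fset1 !mcoeffUU. Qed.

Lemma pa_mul_suml I (r : seq I) (F : I -> KQ) g :
  pa_mul (\sum_(i <- r) F i) g = \sum_(i <- r) pa_mul (F i) g.
Proof. exact: (big_morph (pa_mul^~ g) (fun _ _ => pa_mulDl _ _ _) (pa_mul0g g)). Qed.

Lemma pa_mul_sumr I (r : seq I) (F : I -> KQ) f :
  pa_mul f (\sum_(i <- r) F i) = \sum_(i <- r) pa_mul f (F i).
Proof. exact: (big_morph (pa_mul f) (fun _ _ => pa_mulDr _ _ _) (pa_mulg0 f)). Qed.

Lemma pa_mulA : associative pa_mul.
Proof.
move=> f g h; rewrite (monalgE f) (monalgE g) (monalgE h).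
rewrite [LHS]pa_mul_suml [X in _ = pa_mul X _]pa_mul_suml [RHS]pa_mul_suml.
apply/eq_bigr => p _; rewrite [X in pa_mul _ X = _]pa_mul_suml.
rewrite [LHS]pa_mul_sumr [X in _ = pa_mul X _]pa_mul_sumr [RHS]pa_mul_suml.
apply/eq_bigr => q _; rewrite [X in pa_mul _ X = _]pa_mul_sumr.
rewrite [LHS]pa_mul_sumr [RHS]pa_mul_sumr.
apply/eq_bigr => r _.
move: (f@_p) (g@_q) (h@_r) => a b c.
rewrite [X in pa_mul _ X = _]pa_mulUU [X in _ = pa_mul X _]pa_mulUU.
have := path_compA p q r.
case: (path_comp q r) => [s|]; case: (path_comp p q) => [t|] /= E.
- by rewrite [LHS]pa_mulUU [RHS]pa_mulUU E mulrA.
- by rewrite [LHS]pa_mulUU [RHS]pa_mul0g E.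
- by rewrite [LHS]pa_mulg0 [RHS]pa_mulUU -E.
- by rewrite [LHS]pa_mulg0 [RHS]pa_mul0g.
Qed.

Lemma pa_mul1g : left_id pa_one pa_mul.
Proof.
move=> g; rewrite [RHS]monalgE {1}(monalgE g) pa_mul_sumr.
apply/eq_bigr => q _; rewrite pa_mul_suml (bigD1 (path_target q)) //=.
rewrite big1 => [|v vq]; rewrite pa_mulUU mul1r path_comp_trivl ?(negPf vq) //.
by rewrite eqxx addr0.
Qed.

Lemma pa_mulg1 : right_id pa_one pa_mul.
Proof.
move=> g; rewrite [RHS]monalgE {1}(monalgE g) pa_mul_suml.
apply/eq_bigr => q _; rewrite pa_mul_sumr (bigD1 (path_source q)) //=.
rewrite big1 => [|v vq]; rewrite pa_mulUU mulr1 path_comp_trivr ?(negPf vq) //.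
by rewrite eqxx addr0.
Qed.

HB.instance Definition _ := GRing.Zmodule_isPzRing.Build KQ
  pa_mulA pa_mul1g pa_mulg1 pa_mulDl pa_mulDr.

Definition arrow_elt (a : arrow Q) : KQ := path_elt K (arrow_path a).

End PathAlgebra.

Section IdealQuotient.
Variable A : pzRingType.

Record two_sided_ideal (J : A -> Prop) : Prop := TwoSidedIdeal {
  ideal_zero : J 0;
  ideal_sub : forall x y, J x -> J y -> J (x - y);
  ideal_mull : forall a x, J x -> J (a * x);
  ideal_mulr : forall a x, J x -> J (x * a)
}.

Definition generated_ideal (S : A -> Prop) (x : A) : Prop :=
  forall J : A -> Prop, two_sided_ideal J -> (forall s, S s -> J s) -> J x.

Lemma generated_idealP S : two_sided_ideal (generated_ideal S).
Proof.
split=> [J HJ _|x y Jx Jy J HJ SJ|a x Jx J HJ SJ|a x Jx J HJ SJ].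
- exact: ideal_zero.
- by apply: ideal_sub => //; [apply: Jx|apply: Jy].
- by apply: ideal_mull => //; apply: Jx.
- by apply: ideal_mulr => //; apply: Jx.
Qed.

Variable S : A -> Prop.

Definition in_generated_ideal (x : A) : bool := `[< generated_ideal S x >].

Lemma in_generated_ideal_zmod : zmod_closed in_generated_ideal.
Proof.
have I := generated_idealP S; split=> [|x y].
  by apply/asboolP; apply: (ideal_zero I).
move=> /asboolP Ix /asboolP Iy; apply/asboolP; exact: (ideal_sub I).
Qed.

HB.instance Definition _ :=
  GRing.isZmodClosed.Build A in_generated_ideal in_generated_ideal_zmod.

Definition ring_quotient : Type :=
  {ideal_quot (GRing.ZmodClosed.clone A in_generated_ideal _)}.

HB.instance Definition _ := GRing.Zmodule.on ring_quotient.

Definition quotient_map (x : A) : ring_quotient :=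
  \pi_({ideal_quot (GRing.ZmodClosed.clone A in_generated_ideal _)})%qT x.

Lemma quotient_map_surj (z : ring_quotient) : exists x, z = quotient_map x.
Proof. by exists (repr z); rewrite /quotient_map reprK. Qed.

Lemma quotient_mapP x y :
  quotient_map x = quotient_map y <-> generated_ideal S (x - y).
Proof.
split=> [/eqP|Ixy]; last first.
  by apply/eqP; rewrite -Quotient.idealrBE; apply/asboolP.
by rewrite -Quotient.idealrBE => /asboolP.
Qed.

Definition rq_one : ring_quotient := quotient_map 1.
Definition rq_mul (y z : ring_quotient) : ring_quotient :=
  quotient_map (repr y * repr z).

Lemma quotient_mapD x y :
  quotient_map (x + y) = quotient_map x + quotient_map y.
Proof. by rewrite /quotient_map raddfD. Qed.

Lemma quotient_mapM x y :
  rq_mul (quotient_map x) (quotient_map y) = quotient_map (x * y).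
Proof.
have I := generated_idealP S.
have rK u : generated_ideal S (repr (quotient_map u) - u).
  by apply/quotient_mapP; rewrite /quotient_map reprK.
apply/quotient_mapP; set x' := repr _; set y' := repr _.
have -> : x' * y' - x * y = x' * (y' - y) - (- (x' - x) * y).
  by rewrite mulNr opprK mulrBr mulrBl addrA subrK.
apply: (ideal_sub I); first by apply: (ideal_mull I); apply: rK.
by rewrite mulNr -mulrN; apply: (ideal_mulr I); apply: rK.
Qed.

Lemma rq_mulA : associative rq_mul.
Proof.
move=> x y z; have [x' ->] := quotient_map_surj x.
have [y' ->] := quotient_map_surj y; have [z' ->] := quotient_map_surj z.
by rewrite !quotient_mapM mulrA.
Qed.

Lemma rq_mul1z : left_id rq_one rq_mul.
Proof. by move=> x; have [x' ->] := quotient_map_surj x; rewrite quotient_mapM mul1r. Qed.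

Lemma rq_mulz1 : right_id rq_one rq_mul.
Proof. by move=> x; have [x' ->] := quotient_map_surj x; rewrite quotient_mapM mulr1. Qed.

Lemma rq_mulDl : left_distributive rq_mul +%R.
Proof.
move=> x y z; have [x' ->] := quotient_map_surj x.
have [y' ->] := quotient_map_surj y; have [z' ->] := quotient_map_surj z.
by rewrite -quotient_mapD !quotient_mapM mulrDl quotient_mapD.
Qed.

Lemma rq_mulDr : right_distributive rq_mul +%R.
Proof.
move=> x y z; have [x' ->] := quotient_map_surj x.
have [y' ->] := quotient_map_surj y; have [z' ->] := quotient_map_surj z.
by rewrite -quotient_mapD !quotient_mapM mulrDr quotient_mapD.
Qed.

HB.instance Definition _ := GRing.Zmodule_isPzRing.Build ring_quotient
  rq_mulA rq_mul1z rq_mulz1 rq_mulDl rq_mulDr.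

End IdealQuotient.

Section Modules.
Variable R : pzRingType.

Definition projective (P : lmodType R) : Prop :=
  forall (A B : lmodType R) (g : {linear A -> B}) (f : {linear P -> B}),
    (forall b, exists a, g a = b) ->
    exists h : {linear P -> A}, forall x, g (h x) = f x.

Definition finitely_generated (M : lmodType R) : Prop :=
  exists (n : nat) (m : 'I_n -> M),
    forall x : M, exists c : 'I_n -> R, x = \sum_(i < n) c i *: m i.

(* ... -> P_2 -> P_1 -> P_0 -> M -> 0 *)
Record projective_resolution (M : lmodType R) := ProjectiveResolution {
  res_obj :> nat -> lmodType R;
  res_diff : forall i, {linear res_obj i.+1 -> res_obj i};
  res_aug : {linear res_obj 0 -> M};
  res_projective : forall i, projective (res_obj i);
  res_aug_surj : forall m, exists x, res_aug x = m;
  res_exact0 : forall x, res_aug x = 0 <-> exists y, x = res_diff 0 y;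
  res_exact : forall i x,
    res_diff i x = 0 <-> exists y, x = res_diff i.+1 y
}.

(* H^i(Hom_R(P, N)) = 0: every cocycle is a coboundary. *)
Definition hom_cohomology_zero (M : lmodType R)
    (P : projective_resolution M) (i : nat) (N : lmodType R) : Prop :=
  match i with
  | 0 => forall f : {linear P 0 -> N},
      (forall x, f (res_diff P 0 x) = 0) -> forall x, f x = 0
  | j.+1 => forall f : {linear P j.+1 -> N},
      (forall x, f (res_diff P j.+1 x) = 0) ->
      exists g : {linear P j -> N}, forall x, f x = g (res_diff P j x)
  end.

(* Ext_R^i(M, N) = 0; Ext does not depend on the projective resolution. *)
Definition Ext_zero (i : nat) (M N : lmodType R) : Prop :=
  forall P : projective_resolution M, hom_cohomology_zero P i N.

Definition module_class := lmodType R -> Prop.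

Definition right_perp (C : module_class) : module_class :=
  fun X => forall M, C M -> forall i, (1 <= i)%N -> Ext_zero i M X.

Definition pdim_le (n : nat) : module_class :=
  fun M => exists P : projective_resolution M,
    forall i, (n < i)%N -> forall x : P i, x = 0.

Definition fg_resolvable : module_class :=
  fun M => exists P : projective_resolution M,
    forall i, finitely_generated (P i).

(* For a cotorsion pair AB = (A, B). *)
Definition of_finite_type (AB : module_class * module_class) : Prop :=
  exists S : module_class,
    (forall M, S M -> fg_resolvable M) /\
    (forall X, right_perp S X <-> AB.2 X).

End Modules.

Inductive gamma_vertex := v1 | v2 | v3 | v4.
Inductive gamma_arrow := delta | alpha | beta | gamma | epsilon.

(* [Ordinal] rather than [inord], so that equality tests compute. *)
Definition gamma_vertex_code (v : gamma_vertex) : 'I_4 :=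
  match v with
  | v1 => @Ordinal 4 0 isT | v2 => @Ordinal 4 1 isT
  | v3 => @Ordinal 4 2 isT | v4 => @Ordinal 4 3 isT
  end.
Definition gamma_vertex_decode (i : 'I_4) : gamma_vertex :=
  nth v1 [:: v1; v2; v3; v4] i.
Lemma gamma_vertex_codeK : cancel gamma_vertex_code gamma_vertex_decode.
Proof. by case. Qed.
HB.instance Definition _ :=
  Finite.copy gamma_vertex (can_type gamma_vertex_codeK).

Definition gamma_arrow_code (a : gamma_arrow) : 'I_5 :=
  match a with
  | delta => @Ordinal 5 0 isT | alpha => @Ordinal 5 1 isT
  | beta => @Ordinal 5 2 isT | gamma => @Ordinal 5 3 isT
  | epsilon => @Ordinal 5 4 isT
  end.
Definition gamma_arrow_decode (i : 'I_5) : gamma_arrow :=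
  nth delta [:: delta; alpha; beta; gamma; epsilon] i.
Lemma gamma_arrow_codeK : cancel gamma_arrow_code gamma_arrow_decode.
Proof. by case. Qed.
HB.instance Definition _ :=
  Finite.copy gamma_arrow (can_type gamma_arrow_codeK).

Definition gamma_source (a : gamma_arrow) : gamma_vertex :=
  match a with
  | delta => v3 | alpha => v1 | beta => v1 | gamma => v2 | epsilon => v2
  end.
Definition gamma_target (a : gamma_arrow) : gamma_vertex :=
  match a with
  | delta => v1 | alpha => v2 | beta => v2 | gamma => v1 | epsilon => v4
  end.

Definition Gamma : quiver := Quiver gamma_source gamma_target.

Section Algebra.
Variable K : fieldType.

Local Notation "[ 'arr' a ]" := (arrow_elt K (a : arrow Gamma)).

Inductive Gamma_relation : path_algebra K Gamma -> Prop :=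
  | rel_epsilon_beta : Gamma_relation ([arr epsilon] * [arr beta])
  | rel_gamma_beta : Gamma_relation ([arr gamma] * [arr beta])
  | rel_beta_delta : Gamma_relation ([arr beta] * [arr delta])
  | rel_epsilon_alpha_delta :
      Gamma_relation ([arr epsilon] * [arr alpha] * [arr delta])
  | rel_long_from_v1 (p : qpath Gamma) :
      path_source p = v1 -> (3 <= path_length p)%N ->
      Gamma_relation (path_elt K p)
  | rel_long_from_v2 (p : qpath Gamma) :
      path_source p = v2 -> (2 <= path_length p)%N ->
      Gamma_relation (path_elt K p).

(* K Gamma / I; left modules over it depend only on its ring structure. *)
Definition Gamma_algebra : pzRingType := ring_quotient Gamma_relation.

End Algebra.

(* Main.v *)
Require Import Defs.
From HB Require Import structures.
From mathcomp Require Import all_boot all_order all_algebra.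
From mathcomp Require Import finmap boolp classical_sets functions monalg.

(* Left modules over R are representations of the quiver.

   P_2 is of finite type.  Let A = R e_3 / R alpha delta and B = R e_1 / R alpha;
   their minimal resolutions 0 -> R e_4 -> R e_2 -> R e_3 and 0 -> R e_2 -> R e_1
   show that X lies in {A, B}^perp iff alpha X_1 = X_2, epsilon X_2 = X_4 and
   ker (epsilon on X_2) = alpha delta X_3.  Conversely, fix a projective resolution
   of length 2, so that H^2 is right exact.  Injective modules are acyclic, and so
   are successively their quotients T = (3 - 1 - 2) of I_1 and S_1 of I_2; hence
   H^2 vanishes on all X with X_4 = 0, and H^1 vanishes on a quotient of an acyclic
   module by a kernel with no vertex 4.  A module X as above is an extension of
   I_4 (x) X_4 by a module generated, up to copies of S_1, by its vertex 3, i.e. by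
   a quotient of copies of R e_3 by such a kernel.

   P_1 is not of finite type.  For S consisting of modules with finitely generated
   resolutions, S^perp is closed under direct sums, but P_1^perp is not.  Let
   Xhat = K[[N]] at the vertices 1 and 2, with alpha = 1 and beta = N.  It is an
   N-adically complete iterated extension of E = (1 - 2), a quotient of I_4, so it
   lies in P_1^perp.  The module with generators x_k and relations
   alpha x_k + beta x_(k+1) = 0 (k >= 0) has projective dimension 1, but the
   equations alpha x_k + beta x_(k+1) = y_k, with y_k = 1 in the k-th copy of Xhat,
   force x_0 = +-N^k in the k-th copy and have no solution in the direct sum. *)

Set Implicit Arguments.
Unset Strict Implicit.
Unset Printing Implicit Defensive.

Import GRing.Theory.
Local Open Scope ring_scope.

(** * Linear maps, submodules and quotients *)

Section LinearMaps.
Variable R : pzRingType.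

Definition to_linear (A B : lmodType R) (f : A -> B) (Hf : linear f) :
  {linear A -> B} := HB.pack f (GRing.isLinear.Build R A B *:%R f Hf).

Lemma linear_exists (A B : lmodType R) (f : A -> B) :
  linear f -> exists g : {linear A -> B}, g =1 f.
Proof. by move=> Hf; exists (to_linear Hf). Qed.

(** Injectivity of [i] makes the chosen preimages unique, and uniqueness makes the choice linear. *)
Lemma linear_factor (P A X : lmodType R) (i : {linear A -> X})
    (f : {linear P -> X}) :
  injective i -> (forall p, exists a, i a = f p) ->
  exists g : {linear P -> A}, forall p, i (g p) = f p.
Proof.
move=> inji im; pose g p := sval (cid (im p)).
have gP p : i (g p) = f p by rewrite /g; case: cid.
have [g' g'E] : exists g' : {linear P -> A}, g' =1 g.
  by apply: linear_exists => a x y; apply: inji; rewrite linearP !gP linearP.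
by exists g' => p; rewrite g'E.
Qed.

End LinearMaps.

Section Submodules.
Variables (R : pzRingType) (M : lmodType R).

Record submodule := Submodule {
  sm_pred :> M -> Prop;
  sm_zero : sm_pred 0;
  sm_lin : forall a x y, sm_pred x -> sm_pred y -> sm_pred (a *: x + y)
}.

Variable S : submodule.

Definition sm_mem : {pred M} := fun x => `[< S x >].

Lemma sm_mem_closed : submod_closed sm_mem.
Proof.
split=> [|a x y /asboolP Sx /asboolP Sy]; apply/asboolP.
  exact: sm_zero.
exact: sm_lin.
Qed.

HB.instance Definition _ :=
  GRing.isSubmodClosed.Build R M sm_mem sm_mem_closed.

Definition submod : Type := {x : M | x \in sm_mem}.
HB.instance Definition _ := [isSub of submod for @sval _ _].
HB.instance Definition _ := [Choice of submod by <:].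
HB.instance Definition _ := [SubChoice_isSubLmodule of submod by <:].

Definition submod_incl : {linear submod -> M} :=
  to_linear (fun a (x y : submod) => linearP (val : {linear submod -> M}) a x y).

Lemma submod_incl_inj : injective submod_incl.
Proof. exact: val_inj. Qed.

Lemma submod_inclP x : S (submod_incl x).
Proof. by apply/asboolP; case: x. Qed.

Lemma submod_inclS x : S x -> exists y, submod_incl y = x.
Proof. by move=> Sx; exists (exist _ x (asboolT Sx)). Qed.

(** Cosets are formed for the additive group only; the scalar action is then put on them through
    representatives, and [quot_scaleE] shows that the representative does not matter. *)
Definition quotmod : Type :=
  {ideal_quot (GRing.ZmodClosed.clone M sm_mem _)}.

HB.instance Definition _ := GRing.Zmodule.on quotmod.

Definition quot_pi (x : M) : quotmod :=
  \pi_({ideal_quot (GRing.ZmodClosed.clone M sm_mem _)})%qT x.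

Lemma quot_pi_surj z : exists x, quot_pi x = z.
Proof. by exists (repr z); rewrite /quot_pi reprK. Qed.

Lemma quot_piE x y : quot_pi x = quot_pi y <-> S (x - y).
Proof.
split=> [/eqP|Ixy]; last first.
  by apply/eqP; rewrite -Quotient.idealrBE; apply/asboolP.
by rewrite -Quotient.idealrBE => /asboolP.
Qed.

Lemma quot_piD x y : quot_pi (x + y) = quot_pi x + quot_pi y.
Proof. by rewrite /quot_pi raddfD. Qed.

Definition quot_scale (a : R) (z : quotmod) : quotmod := quot_pi (a *: repr z).

Lemma quot_scaleE a x : quot_scale a (quot_pi x) = quot_pi (a *: x).
Proof.
apply/quot_piE; rewrite -scalerBr -[_ *: _]addr0; apply: sm_lin (sm_zero S).
by apply/quot_piE; rewrite /quot_pi reprK.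
Qed.

Lemma quot_scaleA a b z : quot_scale a (quot_scale b z) = quot_scale (a * b) z.
Proof. by have [x <-] := quot_pi_surj z; rewrite !quot_scaleE scalerA. Qed.
Lemma quot_scale1 : left_id 1 quot_scale.
Proof. by move=> z; have [x <-] := quot_pi_surj z; rewrite quot_scaleE scale1r. Qed.
Lemma quot_scaleDr : right_distributive quot_scale +%R.
Proof.
move=> a z t; have [x <-] := quot_pi_surj z; have [y <-] := quot_pi_surj t.
by rewrite -quot_piD !quot_scaleE scalerDr quot_piD.
Qed.
Lemma quot_scaleDl z a b : quot_scale (a + b) z = quot_scale a z + quot_scale b z.
Proof. by have [x <-] := quot_pi_surj z; rewrite !quot_scaleE scalerDl quot_piD. Qed.

HB.instance Definition _ := GRing.Zmodule_isLmodule.Build R quotmod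
  quot_scaleA quot_scale1 quot_scaleDr quot_scaleDl.

Lemma quot_pi_linear : linear quot_pi.
Proof. by move=> a x y; rewrite quot_piD -quot_scaleE. Qed.

Definition quot_proj : {linear M -> quotmod} := to_linear quot_pi_linear.

Lemma quot_proj_surj z : exists x, quot_proj x = z.
Proof. exact: quot_pi_surj. Qed.

Lemma quot_proj_eq0 x : quot_proj x = 0 <-> S x.
Proof.
have -> : 0 = quot_pi 0 by rewrite -[RHS]/(quot_proj 0) linear0.
by rewrite -[quot_proj x]/(quot_pi x) quot_piE subr0.
Qed.

End Submodules.

Section KernelImage.
Variables (R : pzRingType) (A B : lmodType R) (f : {linear A -> B}).

Lemma ker_sub_lin a x y : f x = 0 -> f y = 0 -> f (a *: x + y) = 0.
Proof. by move=> fx fy; rewrite linearP fx fy scaler0 addr0. Qed.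
Definition ker_sub : submodule A :=
  @Submodule _ _ (fun x => f x = 0) (linear0 f) ker_sub_lin.

Lemma im_sub_zero : exists x, f x = 0.
Proof. by exists 0; rewrite linear0. Qed.
Lemma im_sub_lin a x y :
  (exists u, f u = x) -> (exists u, f u = y) -> exists u, f u = a *: x + y.
Proof. by move=> [u <-] [w <-]; exists (a *: u + w); rewrite linearP. Qed.
Definition im_sub : submodule B :=
  @Submodule _ _ (fun x => exists u, f u = x) im_sub_zero im_sub_lin.
End KernelImage.

(** * Comparison of projective resolutions *)

Section Comparison.
Variable R : pzRingType.

(** The lifting property is stated for surjections; replacing [B] by the image of [d] gives the form
    used along exact sequences. *)
Lemma projective_exact (P A B : lmodType R) (d : {linear A -> B})
    (f : {linear P -> B}) :
  projective P -> (forall p, exists a, f p = d a) ->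
  exists h : {linear P -> A}, forall p, d (h p) = f p.
Proof.
move=> projP im; pose I := im_sub d.
have [d' d'E] := @linear_factor _ A _ _ (submod_incl I) d
  (@submod_incl_inj _ _ I) (fun a => submod_inclS (ex_intro _ a erefl : I (d a))).
have [f' f'E] : exists g : {linear P -> submod I}, forall p, submod_incl I (g p) = f p.
  apply: linear_factor; first exact: submod_incl_inj.
  by move=> p; apply: submod_inclS; have [a ->] := im p; exists a.
have [b|h hE] := projP _ _ d' f'.
  have [a aE] := submod_inclP b; exists a.
  by apply: submod_incl_inj; rewrite d'E.
by exists h => p; rewrite -d'E hE f'E.
Qed.

Lemma res_diff_diff (M : lmodType R) (P : projective_resolution M) i x :
  res_diff P i (res_diff P i.+1 x) = 0.
Proof. by apply/res_exact; exists x. Qed.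

Lemma res_aug_diff (M : lmodType R) (P : projective_resolution M) x :
  res_aug P (res_diff P 0 x) = 0.
Proof. by apply/res_exact0; exists x. Qed.

Definition zero_linear (A B : lmodType R) : {linear A -> B} := \0.

(** A total step function, so that [nat_rect] can build a sequence before its steps are known to be
    possible. That each step exists is proved afterwards by induction, so the default is never
    taken. *)
Definition classical_step (T : Type) (default : T) (Q : T -> Prop) : T :=
  if pselect (exists t, Q t) is left e then sval (cid e) else default.

Lemma classical_stepP (T : Type) (default : T) (Q : T -> Prop) :
  (exists t, Q t) -> Q (classical_step default Q).
Proof. by rewrite /classical_step => e; case: pselect => // e'; case: cid. Qed.

Section Maps.
Variables (M : lmodType R) (P Q : projective_resolution M).

Lemma chain_map_exists : exists u : forall i, {linear P i -> Q i},
  (forall x, res_aug Q (u 0 x) = res_aug P x) /\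
  forall i x, res_diff Q i (u i.+1 x) = u i (res_diff P i x).
Proof.
have [u0 u0E] := @res_projective _ _ P 0 _ _ _ (res_aug P) (@res_aug_surj _ _ Q).
pose step i (u : {linear P i -> Q i}) : {linear P i.+1 -> Q i.+1} :=
  classical_step (zero_linear _ _) (fun u' : {linear P i.+1 -> Q i.+1} =>
    forall x, res_diff Q i (u' x) = u (res_diff P i x)).
pose u := nat_rect (fun i => {linear P i -> Q i}) u0 step.
have stepP i : (forall x, exists y, u i (res_diff P i x) = res_diff Q i y) ->
    forall x, res_diff Q i (u i.+1 x) = u i (res_diff P i x).
  move=> H; apply: (classical_stepP _ (Q := fun u' : {linear P i.+1 -> Q i.+1} =>
    forall x, res_diff Q i (u' x) = u i (res_diff P i x))).
  by have := projective_exact (f := u i \o res_diff P i) (@res_projective _ _ P i.+1) H.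
exists u; split=> // i; elim: i => [|i IHi]; apply: stepP => x.
  by apply/res_exact0; rewrite u0E res_aug_diff.
by apply/res_exact; rewrite IHi res_diff_diff linear0.
Qed.

End Maps.

(** The usual null-homotopy of a chain map over zero. The identity in degree 0, that [w 0] is the
    differential after [h0], only starts the recursion; the conclusion concerns positive degrees. *)
Lemma homotopy_exists (M : lmodType R) (Q : projective_resolution M)
    (w : forall i, {linear Q i -> Q i}) :
  (forall x, res_aug Q (w 0 x) = 0) ->
  (forall i x, res_diff Q i (w i.+1 x) = w i (res_diff Q i x)) ->
  exists h : forall i, {linear Q i -> Q i.+1},
    forall i x, w i.+1 x = res_diff Q i.+1 (h i.+1 x) + h i (res_diff Q i x).
Proof.
move=> w0 wd.
have [h0 h0E] : exists h : {linear Q 0 -> Q 1}, forall x, res_diff Q 0 (h x) = w 0 x.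
  apply: projective_exact; first exact: (@res_projective _ _ Q 0).
  by move=> p; apply/res_exact0.
pose step i (h : {linear Q i -> Q i.+1}) : {linear Q i.+1 -> Q i.+2} :=
  classical_step (zero_linear _ _) (fun h' : {linear Q i.+1 -> Q i.+2} =>
    forall x, res_diff Q i.+1 (h' x) = w i.+1 x - h (res_diff Q i x)).
pose h := nat_rect (fun i => {linear Q i -> Q i.+1}) h0 step.
have stepP i : (forall x, exists y, w i.+1 x - h i (res_diff Q i x) = res_diff Q i.+1 y) ->
    forall x, res_diff Q i.+1 (h i.+1 x) = w i.+1 x - h i (res_diff Q i x).
  move=> H; apply: (classical_stepP _ (Q := fun h' : {linear Q i.+1 -> Q i.+2} =>
    forall x, res_diff Q i.+1 (h' x) = w i.+1 x - h i (res_diff Q i x))).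
  by have := projective_exact (f := w i.+1 \- (h i \o res_diff Q i))
    (@res_projective _ _ Q i.+1) H.
have hE i x : res_diff Q i.+1 (h i.+1 x) = w i.+1 x - h i (res_diff Q i x).
  move: i x; elim=> [|i IHi]; apply: stepP => x; apply/res_exact.
    by rewrite linearB wd h0E subrr.
  by rewrite linearB wd IHi res_diff_diff linear0 subr0 subrr.
by exists h => i x; rewrite hE subrK.
Qed.

(** Since [u \o v] is homotopic to the identity, a cocycle [f] on [Q] differs from [f \o u \o v] by
    the coboundary of [f \o h], and [f \o u] is a coboundary on [P]. Hence one resolution suffices
    to establish [Ext_zero], which quantifies over all of them. *)
Lemma cohomology_transfer (M N : lmodType R) (P Q : projective_resolution M) i :
  hom_cohomology_zero P i.+1 N -> hom_cohomology_zero Q i.+1 N.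
Proof.
have [u [u0 ud]] := chain_map_exists P Q.
have [v [v0 vd]] := chain_map_exists Q P.
have [||h hE] := @homotopy_exists M Q (fun i => idfun \- (u i \o v i)).
- by move=> x /=; rewrite linearB u0 v0 subrr.
- by move=> j x /=; rewrite linearB ud vd.
move=> HP f /= fd.
have [|g gE] := HP (f \o u i.+1).
  by move=> x /=; rewrite -ud fd.
exists ((g \o v i) \+ (f \o h i)) => x /=.
have /= := hE i x => /(congr1 f); rewrite linearB linearD fd add0r => /eqP.
by rewrite subr_eq addrC => /eqP ->; rewrite -vd -gE.
Qed.

Lemma cohomology_Ext (M N : lmodType R) (P : projective_resolution M) i :
  (0 < i)%N -> hom_cohomology_zero P i N -> Ext_zero i M N.
Proof. by case: i => // i _ HP Q; apply: cohomology_transfer HP. Qed.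

End Comparison.

(** * Fragments of the long exact cohomology sequence *)

Section ShortExact.
Variable R : pzRingType.

Definition short_exact (A X B : lmodType R) (j : {linear A -> X})
    (p : {linear X -> B}) : Prop :=
  [/\ injective j, forall b, exists x, p x = b &
      forall x, p x = 0 <-> exists a, j a = x].

Lemma short_exact_quot (X : lmodType R) (S : submodule X) :
  short_exact (submod_incl S) (quot_proj S).
Proof.
split; [exact: (@submod_incl_inj _ _ S)|exact: quot_proj_surj|].
move=> x; rewrite quot_proj_eq0; split=> [/submod_inclS //|[y <-]].
exact: submod_inclP.
Qed.

Lemma short_exact_ker (X B : lmodType R) (p : {linear X -> B}) :
  (forall b, exists x, p x = b) -> short_exact (submod_incl (ker_sub p)) p.
Proof.
move=> surj; split=> [|//|]; first exact: (@submod_incl_inj _ _ (ker_sub p)).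
move=> x; split=> [px|[y <-]]; first exact: (@submod_inclS _ _ (ker_sub p)).
exact: (submod_inclP (S := ker_sub p)).
Qed.

Variables (M : lmodType R) (P : projective_resolution M).
Local Notation H := (hom_cohomology_zero P).
Variables (A X B : lmodType R) (j : {linear A -> X}) (p : {linear X -> B}).
Hypothesis jp : short_exact j p.

(** A cochain bounding [p \o f] lifts to [X] by projectivity; what remains of [f] comes from a
    cocycle in [A]. *)
Lemma cohomology_ext i : H i.+1 A -> H i.+1 B -> H i.+1 X.
Proof.
have [jinj psurj kerp] := jp; have pj a : p (j a) = 0 by apply/kerp; exists a.
move=> HA HB f /= fd.
have [|g gE] := HB (p \o f); first by move=> x /=; rewrite fd linear0.
have [g' g'E] := @res_projective _ _ P i _ _ _ g psurj.
have [x|k kE] := linear_factor (f := f \- (g' \o res_diff P i)) jinj.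
  by apply/kerp => /=; rewrite linearB -[p (f x)]/((p \o f) x) gE g'E subrr.
have [|l lE] := HA k.
  by move=> x; apply: jinj; rewrite kE /= fd res_diff_diff !linear0 addr0.
exists (g' \+ (j \o l)) => x /=.
by rewrite -lE kE /= addrC subrK.
Qed.

(** A cocycle in [B] is lifted to a cochain in [X], whose coboundary comes from [A] and represents
    the connecting map; since it bounds there, the lift can be corrected to a cocycle. *)
Lemma cohomology_coker i : H i.+2 A -> H i.+1 X -> H i.+1 B.
Proof.
have [jinj psurj kerp] := jp; have pj a : p (j a) = 0 by apply/kerp; exists a.
move=> HA HX f /= fd.
have [f' f'E] := @res_projective _ _ P i.+1 _ _ _ f psurj.
have [x|a aE] := linear_factor (f := f' \o res_diff P i.+1) jinj.
  by apply/kerp => /=; rewrite f'E fd.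
have [|b bE] := HA a.
  by move=> x; apply: jinj; rewrite aE /= res_diff_diff !linear0.
have [|g gE] := HX (f' \- (j \o b)).
  by move=> x /=; rewrite -bE aE /= subrr.
exists (p \o g) => x /=.
by rewrite -gE /= linearB f'E pj subr0.
Qed.

(** A cocycle in [A] is the coboundary of some [g] in [X]. Then [p \o g] is a cocycle in [B], and
    subtracting a lift of what it bounds brings [g] into [A]. *)
Lemma cohomology_ker i : H i.+1 B -> H i.+2 X -> H i.+2 A.
Proof.
have [jinj psurj kerp] := jp; have pj a : p (j a) = 0 by apply/kerp; exists a.
move=> HB HX f /= fd.
have [|g gE] := HX (j \o f); first by move=> x /=; rewrite fd linear0.
have [|h hE] := HB (p \o g); first by move=> x /=; rewrite -gE /= pj.
have [h' h'E] := @res_projective _ _ P i _ _ _ h psurj.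
have [x|k kE] := linear_factor (f := g \- (h' \o res_diff P i)) jinj.
  by apply/kerp => /=; rewrite linearB -[p (g x)]/((p \o g) x) hE h'E subrr.
exists k => x; apply: jinj; rewrite kE /= res_diff_diff linear0 subr0.
exact: gE.
Qed.

End ShortExact.

(** * Countable direct sums as finitely supported sequences *)

Section CountableDirectSum.
Variable R : pzRingType.

Section Basics.
Variable M : lmodType R.

Definition fin_supp (f : nat -> M) : Prop :=
  exists n, forall i, (n <= i)%N -> f i = 0.

Lemma fin_supp0 : fin_supp (0 : nat -> M).
Proof. by exists 0. Qed.

Lemma fin_supp_lin a (f g : nat -> M) :
  fin_supp f -> fin_supp g -> fin_supp (a *: f + g).
Proof.
move=> [m fm] [n gn]; exists (maxn m n) => i; rewrite geq_max => /andP[mi ni].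
by rewrite /= [LHS](_ : _ = a *: f i + g i) // fm // gn // scaler0 addr0.
Qed.

Definition dsum : lmodType R := submod (Submodule fin_supp0 fin_supp_lin).

Definition dcoord (x : dsum) (i : nat) : M := submod_incl _ x i.

Lemma dcoordP x : fin_supp (dcoord x).
Proof. exact: (submod_inclP x). Qed.

Lemma dcoord_inj x y : dcoord x =1 dcoord y -> x = y.
Proof. by move=> /funext E; apply: submod_incl_inj. Qed.

Lemma dcoord_lin i a x y :
  dcoord (a *: x + y) i = a *: dcoord x i + dcoord y i.
Proof. by rewrite /dcoord linearP. Qed.

Lemma dcoordZ i a x : dcoord (a *: x) i = a *: dcoord x i.
Proof. by rewrite /dcoord linearZ. Qed.

Lemma dcoord0 i : dcoord 0 i = 0.
Proof. by rewrite /dcoord linear0. Qed.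

Lemma dcoord_linear i : linear (dcoord^~ i).
Proof. by move=> a x y; apply: dcoord_lin. Qed.

Lemma dsum_mk (f : nat -> M) : fin_supp f -> exists x, dcoord x =1 f.
Proof.
move=> ff; have [x xE] := submod_inclS (S := Submodule fin_supp0 fin_supp_lin) ff.
by exists x => i; rewrite /dcoord xE.
Qed.

Lemma dinj_exists i : exists u : {linear M -> dsum},
  forall m j, dcoord (u m) j = if j == i then m else 0.
Proof.
have H m : fin_supp (fun j => if j == i then m else 0).
  by exists i.+1 => j; case: eqP => // ->; rewrite ltnn.
pose u m := sval (cid (dsum_mk (H m))).
have uE m j : dcoord (u m) j = if j == i then m else 0.
  by rewrite /u; case: cid.
have [u' u'E] : exists u' : {linear M -> dsum}, u' =1 u.
  apply: linear_exists => a x y; apply: dcoord_inj => j.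
  by rewrite dcoord_lin !uE; case: eqP => // _; rewrite scaler0 addr0.
by exists u' => m j; rewrite u'E uE.
Qed.

Definition dinj i : {linear M -> dsum} := sval (cid (dinj_exists i)).

Lemma dcoord_dinj i m j : dcoord (dinj i m) j = if j == i then m else 0.
Proof. by rewrite /dinj; case: cid. Qed.

Lemma dcoord_sum n (F : 'I_n -> dsum) j :
  dcoord (\sum_(i < n) F i) j = \sum_(i < n) dcoord (F i) j.
Proof. by rewrite /dcoord linear_sum fct_sumE. Qed.

Lemma dsum_decomp (x : dsum) : exists n, forall m, (n <= m)%N ->
  x = \sum_(i < m) dinj i (dcoord x i).
Proof.
have [n xn] := dcoordP x; exists n => m nm; apply: dcoord_inj => j.
rewrite dcoord_sum; have [jm|mj] := ltnP j m.
  rewrite (bigD1 (Ordinal jm)) //= dcoord_dinj eqxx big1 ?addr0 // => i ij.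
  by rewrite dcoord_dinj; case: eqP => // ji; case/eqP: ij; apply: val_inj.
rewrite xn ?(leq_trans nm) // big1 // => i _.
by rewrite dcoord_dinj gtn_eqF // (leq_trans (ltn_ord i)).
Qed.

(** Each value is a sum up to a chosen bound of the support. Larger bounds give the same sum, so
    linearity is checked at a common bound. *)
Lemma dsum_lift (N : lmodType R) (h : nat -> {linear M -> N}) :
  exists H : {linear dsum -> N}, forall i m, H (dinj i m) = h i m.
Proof.
pose n x := sval (cid (dcoordP x)).
have nP x i : (n x <= i)%N -> dcoord x i = 0.
  by rewrite /n; case: cid => m /= mP; apply: mP.
pose H x := \sum_(i < n x) h i (dcoord x i).
have HE x m : (n x <= m)%N -> H x = \sum_(i < m) h i (dcoord x i).
  move=> nm; rewrite /H (big_ord_widen m (fun i => h i (dcoord x i))) //.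
  rewrite big_mkcond; apply: eq_bigr => i _; case: ltnP => // /nP ->.
  by rewrite linear0.
have [H' H'E] : exists H' : {linear dsum -> N}, H' =1 H.
  apply: linear_exists => a x y; pose m := maxn (n (a *: x + y)) (maxn (n x) (n y)).
  rewrite !(HE _ m) /m ?leq_max ?leqnn ?orbT // scaler_sumr -big_split /=.
  by apply: eq_bigr => i _; rewrite dcoord_lin linearP.
exists H' => i m; rewrite H'E (HE _ (maxn (n (dinj i m)) i.+1)) ?leq_maxl //.
have im : (i < maxn (n (dinj i m)) i.+1)%N by rewrite leq_max leqnn orbT.
rewrite (bigD1 (Ordinal im)) //= dcoord_dinj eqxx big1 ?addr0 // => j ji.
rewrite dcoord_dinj; case: eqP => [jE|_]; last by rewrite linear0.
by case/eqP: ji; apply: val_inj.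
Qed.

Lemma dsum_eq (N : lmodType R) (f g : {linear dsum -> N}) :
  (forall i m, f (dinj i m) = g (dinj i m)) -> f =1 g.
Proof.
move=> fg x; have [n /(_ n (leqnn _)) ->] := dsum_decomp x.
by rewrite !linear_sum; apply: eq_bigr => i _.
Qed.

Lemma dsum_projective : projective M -> projective dsum.
Proof.
move=> projM A B g f surj.
have /choice[h hE] (i : nat) : exists h : {linear M -> A}, forall m, g (h m) = f (dinj i m).
  by have [h hE] := projM _ _ g (f \o dinj i) surj; exists h.
have [H HE] := dsum_lift h; exists H.
by apply: (dsum_eq (f := g \o H)) => i m /=; rewrite HE hE.
Qed.

End Basics.

(** The finitely many generators of [P i.+1] have images in finitely many copies of [X], so only [N]
    coordinates of [f] matter and their bounding maps can be added. This is the closure property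
    that the orthogonal of [pdim_le 1] violates. *)
Lemma cohomology_dsum (M : lmodType R) (P : projective_resolution M)
    (X : lmodType R) i :
  finitely_generated (P i.+1) -> hom_cohomology_zero P i.+1 X ->
  hom_cohomology_zero P i.+1 (dsum X).
Proof.
move=> [n [m mE]] HX f /= fd.
have [N fN] : exists N, forall x k, (N <= k)%N -> dcoord (f x) k = 0.
  have [N fN] : exists N, forall (j : 'I_n) k, (N <= k)%N -> dcoord (f (m j)) k = 0.
    have /choice[b bE] (j : 'I_n) : exists b, forall k, (b <= k)%N -> dcoord (f (m j)) k = 0.
      exact: dcoordP.
    exists (\max_j b j) => j k bk; apply: bE; apply: leq_trans bk.
    exact: leq_bigmax.
  exists N => x k Nk; have [c ->] := mE x; rewrite linear_sum /dcoord linear_sum fct_sumE.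
  apply: big1 => j _; rewrite linearZ linearZ /=.
  by rewrite [LHS](_ : _ = c j *: dcoord (f (m j)) k) // fN // scaler0.
have /choice[g gE] (k : nat) : exists g : {linear P i -> X},
    forall x, dcoord (f x) k = g (res_diff P i x).
  by have := HX (to_linear (@dcoord_linear X k) \o f); apply=> x /=; rewrite fd dcoord0.
have [G GE] : exists G : {linear P i -> dsum X},
    G =1 fun x => \sum_(k < N) dinj X k (g k x).
  apply: linear_exists => a x y; rewrite scaler_sumr -big_split.
  by apply: eq_bigr => k _; rewrite !linearP.
exists G => x; rewrite GE; have [N' xE] := dsum_decomp (f x).
rewrite [LHS](xE (maxn N N')) ?leq_maxr //.
rewrite (big_ord_widen (maxn N N') (fun k => dinj X k (g k (res_diff P i x)))) ?leq_maxl //.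
rewrite [RHS]big_mkcond; apply: eq_bigr => k _; case: ltnP => Nk; first by rewrite gE.
by rewrite fN // linear0.
Qed.

End CountableDirectSum.

(** * Left ideals generated by idempotents *)

Section PrincipalModules.
Variable R : pzRingType.
Variable e : R.

Lemma rid_sub_lin a (x y : R^o) : x * e = x -> y * e = y -> (a *: x + y) * e = a *: x + y.
Proof. by move=> xe ye; rewrite mulrDl ye -mulrA xe. Qed.

(* For e = 0 this is the zero module. *)
Definition rid : lmodType R :=
  submod (@Submodule R R^o (fun r => r * e = r) (mul0r e) rid_sub_lin).

Definition rval : rid -> R := submod_incl _.

Lemma rval_inj : injective rval.
Proof. exact: submod_incl_inj. Qed.

Lemma rvalP x : rval x * e = rval x.
Proof. exact: (submod_inclP x). Qed.

Lemma rval_mk r : r * e = r -> exists x, rval x = r.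
Proof. exact: (@submod_inclS _ _ (@Submodule R R^o (fun r => r * e = r) (mul0r e) rid_sub_lin)). Qed.

Lemma rval_lin a x y : rval (a *: x + y) = a * rval x + rval y.
Proof. by rewrite /rval linearP. Qed.

Lemma rvalZ a x : rval (a *: x) = a * rval x.
Proof. by rewrite /rval linearZ. Qed.

Lemma rval0 : rval 0 = 0.
Proof. by rewrite /rval linear0. Qed.

Lemma rid_map (A : lmodType R) (a : A) :
  exists f : {linear rid -> A}, forall x, f x = rval x *: a.
Proof.
have [f fE] : exists f : {linear rid -> A}, f =1 fun x => rval x *: a.
  by apply: linear_exists => b x y; rewrite rval_lin scalerDl scalerA.
by exists f.
Qed.

Hypothesis ee : e * e = e.

Definition rgen : rid := sval (cid (rval_mk ee)).
Lemma rval_gen : rval rgen = e. Proof. by rewrite /rgen; case: cid. Qed.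
Lemma rgenE x : x = rval x *: rgen.
Proof. by apply: rval_inj; rewrite rvalZ rval_gen rvalP. Qed.

Lemma rid_projective : projective rid.
Proof.
move=> A B g f surj; have [a ga] := surj (f rgen).
have [h hE] := rid_map a; exists h => x.
by rewrite hE linearZ ga -linearZ -rgenE.
Qed.

Lemma rid_fg : finitely_generated rid.
Proof. by exists 1%N, (fun=> rgen) => x; exists (fun=> rval x); rewrite big_ord1 -rgenE. Qed.

End PrincipalModules.

Section CokernelResolution.
Variables (R : pzRingType) (P : nat -> lmodType R).
Variable d : forall i, {linear P i.+1 -> P i}.
Hypothesis projP : forall i, projective (P i).
Hypothesis exactP : forall i x, d i x = 0 <-> exists y, x = d i.+1 y.

Lemma coker_exact0 x :
  quot_proj (im_sub (d 0)) x = 0 <-> exists y, x = d 0 y.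
Proof. by rewrite quot_proj_eq0; split=> -[y yE]; exists y. Qed.

Definition coker_resolution : projective_resolution (quotmod (im_sub (d 0))) :=
  ProjectiveResolution projP (@quot_proj_surj _ _ (im_sub (d 0))) coker_exact0 exactP.

End CokernelResolution.

(** * Extension of linear maps over a field *)

Section LinearExtension.
Variable K : fieldType.
Variables (A B V : lmodType K) (d : {linear A -> B}) (f : {linear A -> V}).
Hypothesis kerf : forall x, d x = 0 -> f x = 0.

(** Graphs of linear maps on subspaces of [B] that contain the image of [d] and are prescribed there
    by [f]; the last condition makes the relation single-valued. *)
Definition partial_ext (G : set (B * V)) : Prop :=
  [/\ forall x, G (d x, f x),
      forall c p q, G p -> G q -> G (c *: p + q) &
      forall v, G (0, v) -> v = 0].

Lemma linear_extension : exists g : {linear B -> V}, forall x, g (d x) = f x.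
Proof.
pose G0 : set (B * V) := fun p => exists x, p = (d x, f x).
pose ok (G : set (B * V)) := G = (@classical_sets.set0 _) \/ partial_ext G.
have [G [okG maxG]] : exists G, ok G /\ forall H, (G `<` H)%classic -> ~ ok H.
  apply: Zorn_bigcup => F okF totF; rewrite /ok.
  have [[G [FG partG]]|nF] := pselect (exists G, F G /\ partial_ext G); last first.
    left; apply/seteqP; split=> // p [G FG Gp]; case: nF; exists G; split=> //.
    by case: (okF _ FG) Gp => // -> [].
  right; split.
  - by move=> x; exists G => //; case: partG.
  - move=> c p q [G1 F1 p1] [G2 F2 q2].
    have part H r : F H -> H r -> partial_ext H.
      by move=> FH Hr; case: (okF _ FH) Hr => // -> [].
    case: (totF _ _ F1 F2) => [/(_ _ p1) p2|/(_ _ q2) q1].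
      by exists G2 => //; case: (part _ _ F2 q2) => _ + _; apply.
    by exists G1 => //; case: (part _ _ F1 p1) => _ + _; apply.
  - move=> v [H FH Hv]; case: (okF _ FH) Hv => [-> []|[_ _]]; exact.
have part0 : partial_ext G0.
  split=> [x|c _ _ [x ->] [y ->]|v [x [dx ->]]]; first by exists x.
    by exists (c *: x + y); rewrite !linearP.
  exact: kerf.
have {okG} [Gd Glin G0v] : partial_ext G.
  case: okG => // GE; case: (maxG G0); last by right.
  by rewrite GE; split=> // /(_ (d 0, f 0)); case; exists 0.
have G00 : G (0, 0) by have := Gd 0; rewrite !linear0.
have GZ c p : G p -> G (c *: p) by move=> Gp; rewrite -[_ *: _]addr0; apply: Glin.
have Gfun b v w : G (b, v) -> G (b, w) -> v = w.
  move=> Gv Gw; apply/eqP; rewrite -subr_eq0; apply/eqP/G0v.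
  have := Glin (-1) _ _ Gw Gv; congr (G _); rewrite scaleN1r; congr pair.
    by rewrite /= addNr.
  by rewrite /= addrC.
have Gtot b : exists v, G (b, v).
  apply: contrapT => nb.
  (* The graph is enlarged by extending the map with the value 0 at [b]. *)
  pose H : set (B * V) := fun p => exists c q, G q /\ p = q + c *: (b, 0).
  apply: (maxG H); first split.
  - by move=> p Gp; exists 0, p; rewrite scale0r addr0.
  - by move=> /(_ (b, 0)) Hb; apply: nb; exists 0; apply: Hb; exists 1, 0; rewrite add0r scale1r.
  right; split.
  - by move=> x; exists 0, (d x, f x); rewrite scale0r addr0.
  - move=> a _ _ [c [p [Gp ->]]] [c' [q [Gq ->]]].
    exists (a * c + c'), (a *: p + q); split; first exact: Glin.
    by rewrite scalerDr scalerA scalerDl addrACA.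
  - move=> v [c [[b' v'] [Gq]]] [] bE vE.
    have vv : v = v' by rewrite vE scaler0 addr0.
    have [c0|c0] := eqVneq c 0.
      by rewrite vv; apply: G0v; move: Gq; rewrite bE c0 scale0r addr0.
    (* With [c] nonzero, the first coordinate would put [b] in the domain of [G]. *)
    case: nb; exists (- c^-1 *: v'); have := GZ (- c^-1) _ Gq; congr (G _).
    congr pair => /=; have /eqP := esym bE; rewrite addr_eq0 => /eqP ->.
    by rewrite scalerN scaleNr opprK scalerA mulVf // scale1r.
pose g b := sval (cid (Gtot b)).
have gP b : G (b, g b) by rewrite /g; case: cid.
have [g' g'E] : exists g' : {linear B -> V}, g' =1 g.
  by apply: linear_exists => c x y; apply: Gfun (gP _) _; exact: (Glin c (x, g x) (y, g y) (gP x) (gP y)).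
by exists g' => x; rewrite g'E; apply: Gfun (gP _) (Gd x).
Qed.

End LinearExtension.

(** * The path algebra and its quotient *)

Section PathAlgebraFacts.
Variables (K : fieldType) (Q : quiver).
Local Notation KQ := (path_algebra K Q).

Definition pterm (c : K) (p : qpath Q) : KQ := << c *g p >>.

Lemma pterm_mul c d p q :
  pa_mul (pterm c p) (pterm d q) = @scaled_path K Q (c * d) (path_comp p q).
Proof. exact: pa_mulUU. Qed.

(** The multiple of the unit by [c]; it is central by [pconst_comm] and carries the vector space
    structure to the quotient ring. *)
Definition pconst (c : K) : KQ := \sum_(v : vertex Q) pterm c (trivial_path v).

Lemma ptermD c d p : pterm (c + d) p = pterm c p + pterm d p.
Proof. exact: monalgUD. Qed.

Lemma pconstD c d : pconst (c + d) = pconst c + pconst d.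
Proof. by rewrite /pconst -big_split; apply: eq_bigr => v _; apply: ptermD. Qed.

Lemma pconst_mull c d p : pa_mul (pconst c) (pterm d p) = pterm (c * d) p.
Proof.
rewrite pa_mul_suml (bigD1 (path_target p)) //= big1 => [|v vp];
  rewrite pterm_mul path_comp_trivl ?(negPf vp) //.
by rewrite eqxx addr0.
Qed.

Lemma pconst_mulr c d p : pa_mul (pterm d p) (pconst c) = pterm (d * c) p.
Proof.
rewrite pa_mul_sumr (bigD1 (path_source p)) //= big1 => [|v vp];
  rewrite pterm_mul path_comp_trivr ?(negPf vp) //.
by rewrite eqxx addr0.
Qed.

Lemma pconst_comm c (f : KQ) : pa_mul (pconst c) f = pa_mul f (pconst c).
Proof.
rewrite (monalgE f) [LHS]pa_mul_sumr [RHS]pa_mul_suml; apply: eq_bigr => p _.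
by rewrite [LHS]pconst_mull [RHS]pconst_mulr mulrC.
Qed.

Lemma pconstM c d : pconst (c * d) = pa_mul (pconst c) (pconst d).
Proof.
rewrite [in RHS]/pconst [RHS]pa_mul_sumr.
by apply: eq_bigr => v _; rewrite [RHS]pconst_mull.
Qed.

(** A nontrivial path is the arrow followed last times a shorter path. *)
Lemma path_algebra_ind (T : KQ -> Prop) :
  T 0 -> (forall x y, T x -> T y -> T (x + y)) ->
  (forall c v, T (pterm c (trivial_path v))) ->
  (forall a x, T x -> T (pa_mul (arrow_elt K a) x)) -> forall x, T x.
Proof.
move=> T0 TD Tv Ta x; rewrite (monalgE x).
elim/big_rec: _ => // p y _ Ty; apply: TD => //.
move: (x@_p) => c {x y Ty}; case: p => -[v w] pw.
elim: w pw => [|a w IHw] pw.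
  rewrite (_ : QPath pw = trivial_path v); [exact: Tv|exact: val_inj].
have /andP[/eqP aE pw'] : is_qpath v (a :: w) by [].
suff -> : << c *g QPath pw >> =
    pa_mul (arrow_elt K a) (pterm c (@QPath Q (v, w) pw')) by apply/Ta/IHw.
rewrite [RHS]pterm_mul mul1r.
have [|r [-> rs rw]] := @path_compP Q (arrow_path a) (@QPath Q (v, w) pw').
  exact: aE.
by congr << _ *g _ >>; apply: qpath_eq; rewrite ?rs ?rw.
Qed.

End PathAlgebraFacts.

Definition qm (K : fieldType) (x : path_algebra K Gamma) : Gamma_algebra K :=
  quotient_map (@Gamma_relation K) x.

(** The classes of scalars, trivial paths and arrows are locked, so that simplification does not
    unfold them into the quotient. *)
HB.lock Definition sc (K : fieldType) (c : K) : Gamma_algebra K :=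
  qm (pconst Gamma c).
HB.lock Definition ev (K : fieldType) (v : gamma_vertex) : Gamma_algebra K :=
  qm (path_elt K (trivial_path (v : vertex Gamma))).
HB.lock Definition ar (K : fieldType) (a : gamma_arrow) : Gamma_algebra K :=
  qm (arrow_elt K (a : arrow Gamma)).

Section GammaAlgebra.
Variable K : fieldType.
Local Notation R := (Gamma_algebra K).
Local Notation KQ := (path_algebra K Gamma).
Local Notation qm := (@qm K).
Local Notation sc := (@sc K).
Local Notation ev := (@ev K).
Local Notation ar := (@ar K).

Lemma qmD x y : qm (x + y) = qm x + qm y.
Proof. exact: quotient_mapD. Qed.
Lemma qmM x y : qm (x * y) = qm x * qm y.
Proof. by symmetry; apply: quotient_mapM. Qed.
Lemma qm1 : qm 1 = 1. Proof. by []. Qed.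
Lemma qm0 : qm 0 = 0.
Proof. by apply: (addrI (qm 0)); rewrite -qmD !addr0. Qed.
Lemma qm_surj r : exists x, r = qm x.
Proof. exact: quotient_map_surj. Qed.
Lemma qm_rel x : Gamma_relation x -> qm x = 0.
Proof.
move=> rx; rewrite -qm0; apply/quotient_mapP; rewrite subr0 => J _; exact.
Qed.

Lemma qm_pa_mul x y : qm (pa_mul x y) = qm x * qm y.
Proof. exact: qmM. Qed.

Lemma sc1 : sc (1 : K) = 1. Proof. by rewrite sc.unlock. Qed.
Lemma scD c d : sc (c + d) = sc c + sc d.
Proof. by rewrite !sc.unlock pconstD qmD. Qed.
Lemma scM c d : sc (c * d) = sc c * sc d.
Proof. by rewrite !sc.unlock pconstM qm_pa_mul. Qed.
Lemma sc_comm c r : sc c * r = r * sc c.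
Proof. by have [x ->] := qm_surj r; rewrite sc.unlock -!qm_pa_mul pconst_comm. Qed.

Lemma path_elt_mul (p q : qpath Gamma) :
  qm (path_elt K p) * qm (path_elt K q) = qm (@scaled_path K Gamma 1 (path_comp p q)).
Proof. by rewrite -qm_pa_mul [X in qm X]pterm_mul mulr1. Qed.

Lemma ev_ev v w : ev v * ev w = if v == w then ev v else 0.
Proof.
rewrite !ev.unlock path_elt_mul path_comp_trivl /path_target /=.
by case: eqP => [->|_] //; rewrite qm0.
Qed.
Lemma ar_ev a v : ar a * ev v = if v == gamma_source a then ar a else 0.
Proof.
rewrite !ar.unlock !ev.unlock path_elt_mul path_comp_trivr /path_source /=.
by case: ifP => _ //; rewrite qm0.
Qed.
Lemma ev_ar v a : ev v * ar a = if v == gamma_target a then ar a else 0.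
Proof.
rewrite !ar.unlock !ev.unlock path_elt_mul path_comp_trivl /path_target /=.
by case: ifP => _ //; rewrite qm0.
Qed.

Lemma sum_gamma_vertex (V : zmodType) (F : gamma_vertex -> V) :
  \sum_v F v = F v1 + F v2 + F v3 + F v4.
Proof.
rewrite (reindex gamma_vertex_decode) /=; last first.
  exists gamma_vertex_code => i _; last exact: gamma_vertex_codeK.
  by case: i => -[|[|[|[|i]]]] // ilt; apply: val_inj.
by rewrite !big_ord_recl big_ord0 addr0 !addrA.
Qed.

Lemma qm_sum (I : Type) (r : seq I) (F : I -> KQ) :
  qm (\sum_(i <- r) F i) = \sum_(i <- r) qm (F i).
Proof. exact: (big_morph qm qmD qm0). Qed.

Lemma sum_ev : ev v1 + ev v2 + ev v3 + ev v4 = 1.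
Proof.
rewrite -(sum_gamma_vertex (fun v => ev v)) -qm1 -[1]/(pa_one K Gamma) /pa_one.
by rewrite qm_sum; apply: eq_bigr => v _; rewrite ev.unlock.
Qed.

Lemma R_ind (T : R -> Prop) :
  T 0 -> (forall x y, T x -> T y -> T (x + y)) ->
  (forall c v, T (sc c * ev v)) ->
  (forall a x, T x -> T (ar a * x)) -> forall x, T x.
Proof.
move=> T0 TD Tv Ta r; have [x ->] := qm_surj r.
elim/path_algebra_ind: x => [|x y|c v|a x].
- by rewrite qm0.
- by rewrite qmD; apply: TD.
- suff -> : qm (pterm c (trivial_path v)) = sc c * ev v by apply: Tv.
  by rewrite sc.unlock ev.unlock -qm_pa_mul [X in _ = qm X]pconst_mull mulr1.
- by rewrite qm_pa_mul; have := Ta a; rewrite ar.unlock; apply.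
Qed.

Lemma rel_eb : ar epsilon * ar beta = 0.
Proof. by rewrite !ar.unlock -!qmM; apply: qm_rel; apply: rel_epsilon_beta. Qed.
Lemma rel_gb : ar gamma * ar beta = 0.
Proof. by rewrite !ar.unlock -!qmM; apply: qm_rel; apply: rel_gamma_beta. Qed.
Lemma rel_bd : ar beta * ar delta = 0.
Proof. by rewrite !ar.unlock -!qmM; apply: qm_rel; apply: rel_beta_delta. Qed.
Lemma rel_ead : ar epsilon * ar alpha * ar delta = 0.
Proof.
rewrite -[LHS](_ : qm (arrow_elt K (epsilon : arrow Gamma) *
  arrow_elt K (alpha : arrow Gamma) * arrow_elt K (delta : arrow Gamma)) = _).
  by apply: qm_rel; apply: rel_epsilon_alpha_delta.
by rewrite !ar.unlock !qmM.
Qed.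

(** The product is a path of length 2 leaving the vertex 2. *)
Lemma rel_xg a : gamma_source a = v1 -> ar a * ar gamma = 0.
Proof.
move=> a1; rewrite !ar.unlock path_elt_mul.
have [|r [-> rs rw]] := @path_compP Gamma (arrow_path (a : arrow Gamma)) (arrow_path (gamma : arrow Gamma)).
  exact: a1.
by apply: qm_rel; apply: rel_long_from_v2; rewrite ?rs // /path_length rw.
Qed.

Lemma rel_comp0 a b : gamma_source a <> gamma_target b -> ar a * ar b = 0.
Proof.
move=> /eqP/negPf ab; have := ar_ev a (gamma_source a); rewrite eqxx => <-.
by rewrite -mulrA ev_ar ab mulr0.
Qed.

End GammaAlgebra.

(** * Representations as modules *)

(** The last two fields account for both families of long paths: as 4 is a sink, a path of length 3
    from 1 or of length 2 from 2 contains $\alpha\gamma$ or $\beta\gamma$. *)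
Record rep (K : fieldType) := Rep {
  r1 : lmodType K; r2 : lmodType K; r3 : lmodType K; r4 : lmodType K;
  rdelta : {linear r3 -> r1};
  ralpha : {linear r1 -> r2};
  rbeta : {linear r1 -> r2};
  rgamma : {linear r2 -> r1};
  repsilon : {linear r2 -> r4};
  rep_eb : forall x, repsilon (rbeta x) = 0;
  rep_gb : forall x, rgamma (rbeta x) = 0;
  rep_bd : forall x, rbeta (rdelta x) = 0;
  rep_ead : forall x, repsilon (ralpha (rdelta x)) = 0;
  rep_ag : forall x, ralpha (rgamma x) = 0;
  rep_bg : forall x, rbeta (rgamma x) = 0
}.

Section RepModule.
Variables (K : fieldType) (V : rep K).
Local Notation R := (Gamma_algebra K).
Local Notation KQ := (path_algebra K Gamma).

Definition rspace : lmodType K := (r1 V * r2 V * (r3 V * r4 V))%type.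

Definition mk4 (x1 : r1 V) (x2 : r2 V) (x3 : r3 V) (x4 : r4 V) : rspace :=
  ((x1, x2), (x3, x4)).
Definition c1 (x : rspace) : r1 V := x.1.1.
Definition c2 (x : rspace) : r2 V := x.1.2.
Definition c3 (x : rspace) : r3 V := x.2.1.
Definition c4 (x : rspace) : r4 V := x.2.2.

Definition vop (v : gamma_vertex) (x : rspace) : rspace :=
  match v with
  | v1 => mk4 (c1 x) 0 0 0
  | v2 => mk4 0 (c2 x) 0 0
  | v3 => mk4 0 0 (c3 x) 0
  | v4 => mk4 0 0 0 (c4 x)
  end.

Definition aop (a : gamma_arrow) (x : rspace) : rspace :=
  match a with
  | delta => mk4 (rdelta V (c3 x)) 0 0 0
  | alpha => mk4 0 (ralpha V (c1 x)) 0 0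
  | beta => mk4 0 (rbeta V (c1 x)) 0 0
  | gamma => mk4 (rgamma V (c2 x)) 0 0 0
  | epsilon => mk4 0 0 0 (repsilon V (c2 x))
  end.

Lemma mk4_lin c x1 x2 x3 x4 y1 y2 y3 y4 :
  c *: mk4 x1 x2 x3 x4 + mk4 y1 y2 y3 y4 =
  mk4 (c *: x1 + y1) (c *: x2 + y2) (c *: x3 + y3) (c *: x4 + y4).
Proof. by []. Qed.

Lemma mk4_0 : mk4 0 0 0 0 = 0. Proof. by []. Qed.

Lemma vop_lin v : linear (vop v).
Proof. by case: v => c x y; rewrite /vop mk4_lin !scaler0 !addr0. Qed.

Lemma aop_lin a : linear (aop a).
Proof.
by case: a => c x y; rewrite /aop mk4_lin !scaler0 !addr0 -linearP.
Qed.

Lemma aop0 a : aop a 0 = 0.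
Proof. exact: (linear0 (to_linear (@aop_lin a))). Qed.

Lemma vop_vop v w x : vop v (vop w x) = if v == w then vop w x else 0.
Proof. by case: v; case: w. Qed.
Lemma vop_aop v a x : vop v (aop a x) = if v == gamma_target a then aop a x else 0.
Proof. by case: v; case: a. Qed.
Lemma aop_vop a v x : aop a (vop v x) = if v == gamma_source a then aop a x else 0.
Proof.
by case: a; case: v; rewrite /aop /vop /c1 /c2 /c3 /= ?linear0.
Qed.

Definition wop (w : seq (arrow Gamma)) (x : rspace) : rspace :=
  foldr (fun a : gamma_arrow => aop a) x w.
(** Projecting to the source first distinguishes the trivial paths and makes non-composable pairs
    act by zero. *)
Definition pop (p : qpath Gamma) (x : rspace) : rspace :=
  wop (path_word p) (vop (path_source p) x).

Lemma wop_lin w : linear (wop w).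
Proof.
elim: w => // a w IHw c x y.
by rewrite -[LHS]/(aop a (wop w _)) IHw aop_lin.
Qed.
Lemma wop0 w : wop w 0 = 0.
Proof. exact: (linear0 (to_linear (@wop_lin w))). Qed.

Lemma pop_lin p : linear (pop p).
Proof. by move=> c x y; rewrite /pop vop_lin wop_lin. Qed.

Definition popl p : {linear rspace -> rspace} := to_linear (@pop_lin p).

Lemma vop_pop v p x : vop v (pop p x) = if v == path_target p then pop p x else 0.
Proof.
rewrite /pop /path_target; case: (path_word p) => [|a w] /=; first exact: vop_vop.
exact: vop_aop.
Qed.

Lemma pop_comp p q x :
  pop p (pop q x) = if path_comp p q is Some r then pop r x else 0.
Proof.
rewrite {1}/pop vop_pop; have [pq|pq] := eqVneq (path_source p) (path_target q).
  by have [r [-> rs rw]] := path_compP pq; rewrite /pop rs rw /wop foldr_cat.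
by rewrite /path_comp (negPf pq) wop0.
Qed.

Definition pact (f : KQ) (x : rspace) : rspace :=
  \sum_(p <- @msupp (qpath Gamma) K f) f@_p *: pop p x.

Lemma pactw (d : {fset qpath Gamma}) (f : KQ) x :
  (@msupp (qpath Gamma) K f `<=` d)%fset -> pact f x = \sum_(p <- d) f@_p *: pop p x.
Proof.
move=> le; rewrite /pact (big_fset_incl _ le) // => p _ /mcoeff_outdom ->.
by rewrite scale0r.
Qed.

Lemma pactD f g x : pact (f + g) x = pact f x + pact g x.
Proof.
rewrite (@pactw (msupp f `|` msupp g)%fset) ?msuppD_le //.
rewrite (@pactw (msupp f `|` msupp g)%fset f) ?fsubsetUl //.
rewrite (@pactw (msupp f `|` msupp g)%fset g) ?fsubsetUr //.
by rewrite -big_split; apply: eq_bigr => p _; rewrite mcoeffD scalerDl.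
Qed.

Lemma pact0 x : pact 0 x = 0.
Proof. by rewrite /pact msupp0 big_seq_fset0. Qed.

Lemma pact_sum I (r : seq I) (F : I -> KQ) x :
  pact (\sum_(i <- r) F i) x = \sum_(i <- r) pact (F i) x.
Proof. exact: (big_morph (pact^~ x) (fun _ _ => pactD _ _ _) (pact0 x)). Qed.

Lemma pact_lin f : linear (pact f).
Proof.
move=> c x y; rewrite /pact scaler_sumr -big_split; apply: eq_bigr => p _.
by rewrite pop_lin scalerDr !scalerA mulrC.
Qed.

Lemma pact_pterm c p x : pact (pterm c p) x = c *: pop p x.
Proof. by rewrite (pactw (d := [fset p]%fset)) ?msuppU_le // big_seq_fset1 mcoeffUU. Qed.

Lemma pact_elt p x : pact (path_elt K p) x = pop p x.
Proof. by have := pact_pterm 1 p x; rewrite scale1r. Qed.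

Lemma pact_scaled_path c o x :
  pact (@scaled_path K Gamma c o) x = if o is Some r then c *: pop r x else 0.
Proof. by case: o => [r|]; rewrite ?pact0 // -pact_pterm. Qed.

Lemma pactM f g x : pact (pa_mul f g) x = pact f (pact g x).
Proof.
pose pl h := to_linear (@pact_lin h).
rewrite {1}(monalgE f) pa_mul_suml pact_sum.
apply: eq_bigr => p _; rewrite [X in pa_mul _ X]monalgE.
rewrite [X in pact X _]pa_mul_sumr pact_sum -[pop p _]/(popl p _) linear_sum scaler_sumr.
apply: eq_bigr => q _; rewrite [X in pact X _]pa_mulUU pact_scaled_path.
rewrite linearZ /= pop_comp; case: (path_comp p q) => [r|]; first by rewrite scalerA.
by rewrite !scaler0.
Qed.

Lemma vop_sum x : vop v1 x + vop v2 x + vop v3 x + vop v4 x = x.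
Proof.
case: x => -[x1 x2] [x3 x4]; rewrite /vop /c1 /c2 /c3 /c4 /mk4 /=.
by congr (_, _, (_, _)); rewrite /= ?addr0 ?add0r.
Qed.

Lemma pact_const c x : pact (pconst Gamma c) x = c *: x.
Proof.
rewrite pact_sum (eq_bigr (fun v : gamma_vertex => c *: vop v x)) => [|v _].
  by rewrite sum_gamma_vertex -!scalerDr vop_sum.
exact: pact_pterm.
Qed.

Lemma pact1 x : pact 1 x = x.
Proof. by rewrite -[RHS]scale1r -pact_const. Qed.

Lemma pact_arrow (a : gamma_arrow) x :
  pact (arrow_elt K (a : arrow Gamma)) x = aop a x.
Proof.
rewrite pact_elt /pop /=.
by rewrite aop_vop eqxx.
Qed.

(** Removing arrows from the left reduces to the shortest lengths, 3 from vertex 1 and 2 from vertex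
    2; there the last two arrows followed are [gamma] and then [alpha] or [beta]. *)
Lemma wop_long (v : gamma_vertex) w x : @is_qpath Gamma v w ->
  v = v1 /\ (3 <= size w)%N \/ v = v2 /\ (2 <= size w)%N -> wop w x = 0.
Proof.
elim: w => [_ [[]|[]]//|a w IHw] /= /andP[/eqP aw pw] H.
have [Hw|Hw] := pselect (v = v1 /\ (3 <= size w)%N \/ v = v2 /\ (2 <= size w)%N).
  by rewrite IHw // aop0.
have : v = v1 /\ size w = 2 \/ v = v2 /\ size w = 1.
  case: H => -[vE H]; [left|right]; split=> //; apply/eqP; rewrite eqn_leq andbC.
    by rewrite -ltnS H leqNgt; apply/negP => H'; apply: Hw; left.
  by rewrite -ltnS H leqNgt; apply/negP => H'; apply: Hw; right.
case=> -[vE]; rewrite vE in aw pw.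
  case: w pw aw {IHw H Hw} => [|b [|c []]] //= /andP[/eqP bc /andP[/eqP cv _]] aw _.
  move: aw bc cv; case: a; case: b; case: c => //= _ _ _; apply/eqP; rewrite -mk4_0;
    by rewrite /aop /c1 /c2 /c3 /mk4 /= ?rep_ag ?rep_bg.
case: w pw aw {IHw H Hw} => [|b []] //= /andP[/eqP bc _] aw _.
move: aw bc; case: a; case: b => //= _ _; apply/eqP; rewrite -mk4_0;
  by rewrite /aop /c1 /c2 /c3 /mk4 /= ?rep_ag ?rep_bg.
Qed.

Lemma pact_rel f x : Gamma_relation f -> pact f x = 0.
Proof.
have paM g h y : pact (g * h) y = pact g (pact h y) by exact: pactM.
case=> [||||p ps pl|p ps pl].
- by rewrite paM !pact_arrow /aop /c1 /c2 /c3 /mk4 /= rep_eb.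
- by rewrite paM !pact_arrow /aop /c1 /c2 /c3 /mk4 /= rep_gb.
- by rewrite paM !pact_arrow /aop /c1 /c2 /c3 /mk4 /= rep_bd.
- by rewrite 2!paM !pact_arrow /aop /c1 /c2 /c3 /mk4 /= rep_ead.
- rewrite pact_elt /pop.
  by rewrite (@wop_long (path_source p)) //; [exact: path_valid|left].
- rewrite pact_elt /pop.
  by rewrite (@wop_long (path_source p)) //; [exact: path_valid|right].
Qed.

(** The elements acting by zero form a two-sided ideal containing the relations. *)
Lemma pact_ideal f x : generated_ideal (@Gamma_relation K) f -> pact f x = 0.
Proof.
move=> If; apply: (If (fun f => forall x, pact f x = 0)); last by move=> g rg y; apply: pact_rel.
have pact_0 g : pact g 0 = 0 by exact: (linear0 (to_linear (@pact_lin g))).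
split=> [y|g h g0 h0 y|g h h0 y|g h h0 y]; first exact: pact0.
- have := pactD (g - h) h y; rewrite subrK g0 h0 addr0; exact: esym.
- by rewrite -[_ * _]/(pa_mul _ _) pactM h0.
- by rewrite -[_ * _]/(pa_mul _ _) pactM h0.
Qed.

Definition rmod : Type := rspace.
HB.instance Definition _ := GRing.Zmodule.on rmod.

Definition rscale (z : R) (x : rmod) : rmod := pact (repr z) x.

Lemma rscaleE f x : rscale (qm f) x = pact f x.
Proof.
have If : generated_ideal (@Gamma_relation K) (repr (qm f) - f).
  by apply/quotient_mapP; rewrite /qm /quotient_map reprK.
by have := pactD (repr (qm f) - f) f x; rewrite subrK (pact_ideal x If) add0r.
Qed.

Lemma rscaleA a b x : rscale a (rscale b x) = rscale (a * b) x.
Proof.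
have [f ->] := qm_surj a; have [g ->] := qm_surj b.
by rewrite -qm_pa_mul !rscaleE pactM.
Qed.
Lemma rscale1 : left_id 1 rscale.
Proof. by move=> x; rewrite -qm1 rscaleE pact1. Qed.
Lemma rscaleDr : right_distributive rscale +%R.
Proof.
move=> a x y; have [f ->] := qm_surj a; rewrite !rscaleE.
exact: (linearD (to_linear (@pact_lin f))).
Qed.
Lemma rscaleDl x a b : rscale (a + b) x = rscale a x + rscale b x.
Proof.
have [f ->] := qm_surj a; have [g ->] := qm_surj b.
by rewrite -qmD !rscaleE pactD.
Qed.

HB.instance Definition _ := GRing.Zmodule_isLmodule.Build R rmod
  rscaleA rscale1 rscaleDr rscaleDl.

Lemma rmod_ev v (x : rmod) : ev K v *: x = vop v x.
Proof.
by rewrite ev.unlock -[LHS]/(rscale _ _) rscaleE pact_elt.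
Qed.

Lemma rmod_ar a (x : rmod) : ar K a *: x = aop a x.
Proof. by rewrite ar.unlock -[LHS]/(rscale _ _) rscaleE pact_arrow. Qed.

Lemma rmod_sc c (x : rmod) : sc c *: x = c *: (x : rspace).
Proof.
by rewrite sc.unlock -[LHS]/(rscale _ _) rscaleE pact_const.
Qed.

End RepModule.

(** * Modules in terms of vertices and arrows *)

Section GammaModules.
Variable K : fieldType.
Local Notation R := (Gamma_algebra K).
Local Notation sc := (@sc K).
Local Notation ev := (@ev K).
Local Notation ar := (@ar K).

Section Restriction.
Variable M : lmodType R.
(** Restriction of scalars along [sc]. The carrier is unchanged, so the same function can be read as
    linear over [K] or over the algebra. *)
Definition kres : Type := M.
HB.instance Definition _ := GRing.Zmodule.on kres.
Definition kscale (c : K) (x : kres) : kres := sc c *: (x : M).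
Lemma kscaleA a b z : kscale a (kscale b z) = kscale (a * b) z.
Proof. by rewrite /kscale scalerA -scM. Qed.
Lemma kscale1 : left_id 1 kscale.
Proof. by move=> z; rewrite /kscale sc1 scale1r. Qed.
Lemma kscaleDr : right_distributive kscale +%R.
Proof. by move=> a z t; rewrite /kscale scalerDr. Qed.
Lemma kscaleDl z a b : kscale (a + b) z = kscale a z + kscale b z.
Proof. by rewrite /kscale scD scalerDl. Qed.
HB.instance Definition _ := GRing.Zmodule_isLmodule.Build K kres
  kscaleA kscale1 kscaleDr kscaleDl.

Lemma kscaleE c (x : kres) : c *: x = sc c *: (x : M) :> M.
Proof. by []. Qed.

Lemma kact_linear (r : R) : linear (fun x : kres => (r *: (x : M)) : kres).
Proof.
move=> c x y; rewrite [LHS]scalerDr; congr (_ + _).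
by rewrite [RHS]kscaleE [LHS](_ : _ = r *: (sc c *: (x : M))) // !scalerA sc_comm.
Qed.
Definition kact (r : R) : {linear kres -> kres} := to_linear (@kact_linear r).
Lemma kactE r x : kact r x = r *: (x : M). Proof. by []. Qed.
End Restriction.

Section RestrictionMaps.
Variables (M N : lmodType R).
Lemma kmap_linear (f : {linear M -> N}) : linear (f : kres M -> kres N).
Proof.
move=> c x y; rewrite [LHS](_ : _ = f (sc c *: (x : M) + (y : M))) //.
by rewrite linearP.
Qed.
Definition kmap (f : {linear M -> N}) : {linear kres M -> kres N} :=
  to_linear (@kmap_linear f).

Lemma gamma_linear (f : {linear kres M -> kres N}) :
  (forall v (x : M), f (ev v *: x) = ev v *: (f x : N)) ->
  (forall a (x : M), f (ar a *: x) = ar a *: (f x : N)) ->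
  linear (f : M -> N).
Proof.
move=> fv fa r x y; rewrite [LHS]linearD; congr (_ + _).
elim/R_ind: r x => [|r s IHr IHs|c v|a r IHr] x.
- by rewrite !scale0r [LHS]linear0.
- by rewrite !scalerDl [LHS]linearD IHr IHs.
- rewrite -!scalerA -fv; exact: (linearZ_LR f c ((ev v *: x : M) : kres M)).
- by rewrite -!scalerA fa IHr.
Qed.
End RestrictionMaps.

(* [==] on vertices does not reduce under [/=], this test does. *)
Definition isv (v w : gamma_vertex) : bool :=
  match v, w with
  | v1, v1 | v2, v2 | v3, v3 | v4, v4 => true
  | _, _ => false
  end.
Lemma isvE v w : (v == w) = isv v w. Proof. by case: v; case: w. Qed.

Lemma evev v w : ev v * ev w = if isv v w then ev v else 0.
Proof. by rewrite ev_ev isvE. Qed.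
Lemma arev a v : ar a * ev v = if isv v (gamma_source a) then ar a else 0.
Proof. by rewrite ar_ev isvE. Qed.
Lemma evar v a : ev v * ar a = if isv v (gamma_target a) then ar a else 0.
Proof. by rewrite ev_ar isvE. Qed.

Definition nonzero2 (a b : gamma_arrow) : bool :=
  match a, b with
  | alpha, delta | gamma, alpha | epsilon, alpha => true
  | _, _ => false
  end.
Lemma ar_ar0 a b : nonzero2 a b = false -> ar a * ar b = 0.
Proof.
case: a; case: b => //= _; first [exact: rel_eb | exact: rel_gb |
  exact: rel_bd | by apply: rel_xg | by apply: rel_comp0].
Qed.

Definition arar0 := (
  ar_ar0 (a := delta) (b := delta) erefl, ar_ar0 (a := delta) (b := alpha) erefl,
  ar_ar0 (a := delta) (b := beta) erefl, ar_ar0 (a := delta) (b := gamma) erefl,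
  ar_ar0 (a := delta) (b := epsilon) erefl,
  ar_ar0 (a := alpha) (b := alpha) erefl, ar_ar0 (a := alpha) (b := beta) erefl,
  ar_ar0 (a := alpha) (b := gamma) erefl, ar_ar0 (a := alpha) (b := epsilon) erefl,
  ar_ar0 (a := beta) (b := delta) erefl, ar_ar0 (a := beta) (b := alpha) erefl,
  ar_ar0 (a := beta) (b := beta) erefl, ar_ar0 (a := beta) (b := gamma) erefl,
  ar_ar0 (a := beta) (b := epsilon) erefl,
  (ar_ar0 (a := gamma) (b := delta) erefl, ar_ar0 (a := gamma) (b := beta) erefl,
  ar_ar0 (a := gamma) (b := gamma) erefl, ar_ar0 (a := gamma) (b := epsilon) erefl,
  ar_ar0 (a := epsilon) (b := delta) erefl, ar_ar0 (a := epsilon) (b := beta) erefl,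
  ar_ar0 (a := epsilon) (b := gamma) erefl, ar_ar0 (a := epsilon) (b := epsilon) erefl)).

Lemma ev_sum (M : lmodType R) (x : M) :
  x = ev v1 *: x + ev v2 *: x + ev v3 *: x + ev v4 *: x.
Proof. by rewrite -!scalerDl sum_ev scale1r. Qed.

Section RepHoms.
Variables (V : rep K) (M : lmodType R).

(** The components are defined on all of [M] and required to factor through the idempotents, so the
    subspaces $e_v M$ need not be formed. *)
Lemma hom_to_rmod (f1 : {linear kres M -> r1 V}) (f2 : {linear kres M -> r2 V})
    (f3 : {linear kres M -> r3 V}) (f4 : {linear kres M -> r4 V}) :
  (forall x : M, f1 (ev v1 *: x) = f1 x) -> (forall x : M, f2 (ev v2 *: x) = f2 x) ->
  (forall x : M, f3 (ev v3 *: x) = f3 x) -> (forall x : M, f4 (ev v4 *: x) = f4 x) ->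
  (forall x : M, rdelta V (f3 x) = f1 (ar delta *: x)) ->
  (forall x : M, ralpha V (f1 x) = f2 (ar alpha *: x)) ->
  (forall x : M, rbeta V (f1 x) = f2 (ar beta *: x)) ->
  (forall x : M, rgamma V (f2 x) = f1 (ar gamma *: x)) ->
  (forall x : M, repsilon V (f2 x) = f4 (ar epsilon *: x)) ->
  exists h : {linear M -> rmod V}, forall x, h x = mk4 (f1 x) (f2 x) (f3 x) (f4 x).
Proof.
move=> e1 e2 e3 e4 fd fa fb fg fe.
have lin : linear (fun x : kres M => mk4 (f1 x) (f2 x) (f3 x) (f4 x) : kres (rmod V)).
  move=> c x y; rewrite !linearP -mk4_lin; congr (_ + _).
  by symmetry; apply: rmod_sc.
have l : linear (to_linear lin : M -> rmod V); last by exists (to_linear l).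
apply: gamma_linear => [v x|a x]; rewrite ?rmod_ev ?rmod_ar /=.
  rewrite -e1 -e2 -e3 -e4 !scalerA !evev.
  by case: v => /=; rewrite ?scale0r ?linear0 ?e1 ?e2 ?e3 ?e4 /vop.
rewrite -(e1 (_ *: _)) -(e2 (_ *: _)) -(e3 (_ *: _)) -(e4 (_ *: _)) !scalerA !evar.
by case: a => /=; rewrite ?scale0r ?linear0 /aop /c1 /c2 /c3 /= ?fd ?fa ?fb ?fg ?fe.
Qed.

Lemma krmodZ c (x : kres (rmod V)) : c *: x = (c *: (x : rspace V) : rspace V).
Proof. exact: rmod_sc. Qed.

Lemma c1_linear : linear (@c1 K V : kres (rmod V) -> r1 V).
Proof. by move=> c x y; rewrite krmodZ. Qed.
Lemma c2_linear : linear (@c2 K V : kres (rmod V) -> r2 V).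
Proof. by move=> c x y; rewrite krmodZ. Qed.
Lemma c3_linear : linear (@c3 K V : kres (rmod V) -> r3 V).
Proof. by move=> c x y; rewrite krmodZ. Qed.
Lemma c4_linear : linear (@c4 K V : kres (rmod V) -> r4 V).
Proof. by move=> c x y; rewrite krmodZ. Qed.
Definition rc1 := to_linear c1_linear.
Definition rc2 := to_linear c2_linear.
Definition rc3 := to_linear c3_linear.
Definition rc4 := to_linear c4_linear.

Lemma hom_from_rmod (g1 : {linear r1 V -> kres M}) (g2 : {linear r2 V -> kres M})
    (g3 : {linear r3 V -> kres M}) (g4 : {linear r4 V -> kres M}) :
  (forall x, ev v1 *: (g1 x : M) = g1 x) -> (forall x, ev v2 *: (g2 x : M) = g2 x) ->
  (forall x, ev v3 *: (g3 x : M) = g3 x) -> (forall x, ev v4 *: (g4 x : M) = g4 x) ->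
  (forall x, ar delta *: (g3 x : M) = g1 (rdelta V x)) ->
  (forall x, ar alpha *: (g1 x : M) = g2 (ralpha V x)) ->
  (forall x, ar beta *: (g1 x : M) = g2 (rbeta V x)) ->
  (forall x, ar gamma *: (g2 x : M) = g1 (rgamma V x)) ->
  (forall x, ar epsilon *: (g2 x : M) = g4 (repsilon V x)) ->
  exists h : {linear rmod V -> M},
    forall x, h x = (g1 (c1 x) : M) + g2 (c2 x) + g3 (c3 x) + g4 (c4 x).
Proof.
move=> e1 e2 e3 e4 fd fa fb fg fe.
pose f : {linear kres (rmod V) -> kres M} :=
  (g1 \o rc1) \+ (g2 \o rc2) \+ (g3 \o rc3) \+ (g4 \o rc4).
have l : linear (f : rmod V -> M); last by exists (to_linear l).
apply: gamma_linear => [v x|a x]; rewrite ?rmod_ev ?rmod_ar /=.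
  rewrite -e1 -e2 -e3 -e4 -(e1 (c1 x)) -(e2 (c2 x)) -(e3 (c3 x)) -(e4 (c4 x)) !scalerDr !scalerA !evev.
  by case: v => /=; rewrite ?linear0 ?scale0r ?scaler0 ?addr0 ?add0r.
rewrite -(e1 (c1 x)) -(e2 (c2 x)) -(e3 (c3 x)) -(e4 (c4 x)) !scalerDr !scalerA !arev.
by case: a => /=; rewrite ?linear0 ?scale0r ?addr0 ?add0r ?fd ?fa ?fb ?fg ?fe.
Qed.

End RepHoms.

(** This characterizes $J = \mathrm{Hom}_K(e_v R, V)$, with [c] the evaluation at $e_v$, by the
    adjunction $\mathrm{Hom}_R(P, J) = \mathrm{Hom}_K(e_v P, V)$. *)
Definition coinduced (v : gamma_vertex) (J : lmodType R) : Prop :=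
  exists (V : lmodType K) (c : {linear kres J -> V}),
  [/\ forall x : J, c (ev v *: x) = c x,
      forall x : J, (forall r : R, c (r *: x) = 0) -> x = 0 &
      forall (P : lmodType R) (f : {linear kres P -> V}),
        exists h : {linear P -> J}, forall p : P, c (h p) = f (ev v *: p)].

(** Coinduced modules are injective: [c \o f] vanishes on the kernel of the differential, so it
    extends along it over the field, and the adjunction turns the extension into a map to [J]. *)
Lemma coinduced_cohomology v (J M : lmodType R) (P : projective_resolution M) i :
  coinduced v J -> hom_cohomology_zero P i.+1 J.
Proof.
move=> [V [c [cv c0 cJ]]] f /= fd.
have [x /= dx|g gE] := @linear_extension _ _ _ _ (kmap (res_diff P i)) (c \o kmap f).
  have /res_exact [y yE] : res_diff P i x = 0 by [].
  by rewrite -[LHS]/(c (f x)) yE fd linear0.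
have [h hE] := cJ _ g.
have chd y : c (h (res_diff P i y)) = c (f y).
  rewrite hE -linearZ -[LHS]/(g (kmap (res_diff P i) _)) gE /=.
  by rewrite -[RHS]cv; congr (c _); apply: linearZ.
exists h => x; apply/eqP; rewrite -subr_eq0; apply/eqP/c0 => r.
by rewrite scalerBr -!linearZ [LHS]linearB chd subrr.
Qed.

End GammaModules.

(** * Injective representations *)

Ltac gamma_simp := by move=> x /=; rewrite ?kactE ?scalerA -?mulrA ?arev ?evar ?evev /=;
    rewrite ?mulrA ?rel_ead ?arar0 -?mulrA ?arar0 ?mulr0 ?mul0r ?scale0r ?linear0.

Section ConcreteReps.
Variable K : fieldType.
Local Notation R := (Gamma_algebra K).
Local Notation sc := (@sc K).
Local Notation ev := (@ev K).
Local Notation ar := (@ar K).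

Section Pairs.
Variables (U V : lmodType K).
Lemma fst_linear_map : linear (fst : V * V -> V). Proof. by []. Qed.
Lemma snd_linear_map : linear (snd : V * V -> V). Proof. by []. Qed.
Definition lfst := to_linear fst_linear_map.
Definition lsnd := to_linear snd_linear_map.
Lemma lpair_linear (f g : {linear U -> V}) : linear (fun x => (f x, g x)).
Proof. by move=> c x y; rewrite !linearP. Qed.
Definition lpair f g := to_linear (lpair_linear f g).
Definition id_linear : {linear V -> V} := idfun.
Definition lzero : {linear U -> V} := zero_linear U V.
End Pairs.

Definition kzero : lmodType K := 'rV[K]_0.
Lemma kzero_eq (x : kzero) : x = 0. Proof. exact: thinmx0. Qed.

Lemma rmod_eq (W : rep K) (x y : rmod W) :
  c1 x = c1 y -> c2 x = c2 y -> c3 x = c3 y -> c4 x = c4 y -> x = y.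
Proof.
by case: x => -[? ?] [? ?]; case: y => -[? ?] [? ?] /=;
  rewrite /c1 /c2 /c3 /c4 /= => -> -> -> ->.
Qed.

Variable V : lmodType K.
Local Notation lid := (id_linear V).
Local Notation VV := (V * V : lmodType K)%type.

(* [rep_Iv] is the injective hull of S_v tensored with V: its coordinates are
   dual to the nonzero paths ending at v. *)
Definition rep_I4 : rep K.
Proof.
by apply: (@Rep K V V kzero V (lzero _ _) lid (lzero _ _) (lzero _ _) lid) => x //=;
  rewrite ?linear0.
Defined.

(* At vertex 1 the coordinates are dual to alpha and beta. *)
Definition rep_I2 : rep K.
Proof.
by apply: (@Rep K VV V V kzero (lpair lid (lzero _ _)) (lfst V) (lsnd V)
  (lzero _ _) (lzero _ _)) => x //=.
Defined.

(* At vertex 1 the coordinates are dual to e_1 and gamma alpha, at vertex 3 to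
   delta and gamma alpha delta. *)
Definition rep_I1 : rep K.
Proof.
by apply: (@Rep K VV V VV kzero idfun (lsnd V) (lzero _ _)
  (lpair lid (lzero _ _)) (lzero _ _)) => x //=; rewrite ?linear0.
Defined.

(* The uniserial module 3 - 1 - 2, which is both a quotient of I_1 and a
   submodule of I_2. *)
Definition rep_T : rep K.
Proof.
by apply: (@Rep K V V V kzero lid lid (lzero _ _) (lzero _ _) (lzero _ _)) => x //=.
Defined.

(* R e_3 tensored with V; vertex 1 carries delta and gamma alpha delta. *)
Definition rep_P3 : rep K.
Proof.
by apply: (@Rep K VV V V kzero (lpair lid (lzero _ _)) (lfst V) (lzero _ _)
  (lpair (lzero _ _) lid) (lzero _ _)) => x //=.
Defined.

(** The coordinates are recovered at vertex 4 by acting with the nonzero paths ending there: $e_4$,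
    $\epsilon$ and $\epsilon\alpha$. The next two modules are treated in the same way. *)
Lemma coinduced_I4 : coinduced v4 (rmod rep_I4).
Proof.
exists V, (rc4 rep_I4); split=> [x|x H|P f].
- by rewrite rmod_ev.
- have := H (ar epsilon * ar alpha); rewrite -scalerA !rmod_ar /= => H1.
  have := H (ar epsilon); rewrite rmod_ar /= => H2.
  have := H 1; rewrite scale1r => H4.
  by apply: rmod_eq; [exact: H1|exact: H2|rewrite [LHS]kzero_eq|exact: H4].
- have [||||||||| h hE] := @hom_to_rmod _ rep_I4 P (f \o kact P (ar epsilon * ar alpha))
    (f \o kact P (ar epsilon)) (lzero _ _) (f \o kact P (ev v4)); try gamma_simp.
  by exists h => p; rewrite hE.
Qed.

Lemma coinduced_I2 : coinduced v2 (rmod rep_I2).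
Proof.
exists V, (rc2 rep_I2); split=> [x|x H|P f].
- by rewrite rmod_ev.
- have := H (ar alpha); rewrite rmod_ar /= => H1.
  have := H (ar beta); rewrite rmod_ar /= => H1'.
  have := H (ar alpha * ar delta); rewrite -scalerA !rmod_ar /= => H3.
  have := H 1; rewrite scale1r => H2.
  apply: rmod_eq; [|exact: H2|exact: H3|by rewrite [LHS]kzero_eq].
  by rewrite [LHS]surjective_pairing; congr (_, _); [exact: H1|exact: H1'].
- have [||||||||| h hE] := @hom_to_rmod _ rep_I2 P
    (lpair (f \o kact P (ar alpha)) (f \o kact P (ar beta)))
    (f \o kact P (ev v2)) (f \o kact P (ar alpha * ar delta)) (lzero _ _); try gamma_simp.
  by exists h => p; rewrite hE.
Qed.

Lemma coinduced_I1 : coinduced v1 (rmod rep_I1).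
Proof.
exists V, (lfst V \o rc1 rep_I1); split=> [x|x H|P f].
- by rewrite rmod_ev.
- have := H (ar gamma * ar alpha); rewrite -scalerA !rmod_ar /= => H1.
  have := H (ar gamma); rewrite rmod_ar /= => H2.
  have := H (ar delta); rewrite rmod_ar /= => H3.
  have := H (ar gamma * ar alpha * ar delta); rewrite -!scalerA !rmod_ar /= => H3'.
  have := H 1; rewrite scale1r => H1'.
  apply: rmod_eq; [|exact: H2| |by rewrite [LHS]kzero_eq];
    rewrite [LHS]surjective_pairing; congr (_, _).
  + exact: H1'.
  + exact: H1.
  + exact: H3.
  + exact: H3'.
- have [||||||||| h hE] := @hom_to_rmod _ rep_I1 P
    (lpair (f \o kact P (ev v1)) (f \o kact P (ar gamma * ar alpha)))
    (f \o kact P (ar gamma))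
    (lpair (f \o kact P (ar delta)) (f \o kact P (ar gamma * ar alpha * ar delta)))
    (lzero _ _); try gamma_simp.
  by exists h => p; rewrite hE.
Qed.

End ConcreteReps.

(** * Modules with vanishing cohomology *)

Section VanishingCohomology.
Variable K : fieldType.
Local Notation R := (Gamma_algebra K).
Local Notation sc := (@sc K).
Local Notation ev := (@ev K).
Local Notation ar := (@ar K).

Implicit Types (X A : lmodType R) (V : lmodType K).

Lemma gamma_sub_lin (M : lmodType R) (S : M -> Prop) :
  S 0 -> (forall x y, S x -> S y -> S (x + y)) ->
  (forall c x, S x -> S (sc c *: x)) -> (forall v x, S x -> S (ev v *: x)) ->
  (forall a x, S x -> S (ar a *: x)) ->
  forall r x y, S x -> S y -> S (r *: x + y).
Proof.
move=> S0 SD Ss Sv Sa r x y Sx Sy; apply: (SD) => //.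
elim/R_ind: r x Sx => [|r s IHr IHs|c v|a r IHr] x Sx.
- by rewrite scale0r.
- by rewrite scalerDl; apply: SD; [apply: IHr|apply: IHs].
- by rewrite -scalerA; apply/Ss/Sv.
- by rewrite -scalerA; apply/Sa/IHr.
Qed.

(** The kernel of one ring element is not a submodule in general; the hypotheses test stability
    under scalars, idempotents and arrows. *)
Lemma ann_sub_lin (M : lmodType R) (e : R) :
  (forall c, e * sc c = sc c * e) ->
  (forall v (x : M), e *: x = 0 -> (e * ev v) *: x = 0) ->
  (forall a (x : M), e *: x = 0 -> (e * ar a) *: x = 0) ->
  forall r (x y : M), e *: x = 0 -> e *: y = 0 -> e *: (r *: x + y) = 0.
Proof.
move=> es ee ea; apply: gamma_sub_lin => [|x y ex ey|c x ex|v x ex|a x ex].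
- by rewrite scaler0.
- by rewrite scalerDr ex ey addr0.
- by rewrite scalerA es -scalerA ex scaler0.
- by rewrite scalerA ee.
- by rewrite scalerA ea.
Qed.

(** As all arrows then act by zero ([conc_ar]), these are the direct sums of copies of the simple
    module at [v]. *)
Definition conc (v : gamma_vertex) (X : lmodType R) := forall x : X, ev v *: x = x.

Lemma conc_ar v X a (x : X) : conc v X -> ar a *: x = 0.
Proof.
move=> cX; rewrite -(cX x) -(cX (_ *: _)) !scalerA evar.
by case: v {cX}; case: a => /=; rewrite ?mul0r ?scale0r // arev /= scale0r.
Qed.

Lemma conc_ev v w X (x : X) : conc v X -> ev w *: x = if isv w v then x else 0.
Proof.
by move=> cX; rewrite -{1}(cX x) scalerA evev; case: v w cX => -[] cX /=; rewrite ?scale0r.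
Qed.

(** No arrow ends at the vertex 3, so $e_3 R$ is spanned by $e_3$ and the modules concentrated there
    are injective. *)
Lemma coinduced_conc3 X : conc v3 X -> coinduced v3 X.
Proof.
move=> cX; exists (kres X), idfun; split=> [x|x H|P f].
- exact: cX.
- by have := H 1; rewrite /= scale1r.
pose g : {linear kres P -> kres X} := f \o kact P (ev v3).
have gE x : g x = f (ev v3 *: (x : P)) by [].
have l : linear (g : P -> X).
  apply: gamma_linear => [v x|a x]; rewrite !gE scalerA.
    rewrite (conc_ev _ _ cX) evev.
    by case: v => /=; rewrite ?scale0r ?linear0.
  by rewrite (conc_ar _ _ cX) evar; case: a => /=; rewrite scale0r linear0.
by exists (to_linear l).
Qed.

Variables (M : lmodType R) (P : projective_resolution M).
Local Notation H := (hom_cohomology_zero P).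

Lemma cohomology_I1 V i : H i.+1 (rmod (rep_I1 V)).
Proof. exact: coinduced_cohomology (coinduced_I1 V). Qed.
Lemma cohomology_I2 V i : H i.+1 (rmod (rep_I2 V)).
Proof. exact: coinduced_cohomology (coinduced_I2 V). Qed.
Lemma cohomology_I4 V i : H i.+1 (rmod (rep_I4 V)).
Proof. exact: coinduced_cohomology (coinduced_I4 V). Qed.
Lemma cohomology_conc3 X i : conc v3 X -> H i.+1 X.
Proof. by move=> /coinduced_conc3; apply: coinduced_cohomology. Qed.

(** $I_4$ is uniserial, 1 - 2 - 4, with the simple module at 1 on top. *)
Lemma conc1_I4 X : conc v1 X ->
  exists p : {linear rmod (rep_I4 (kres X)) -> X}, forall x, exists y, p y = x.
Proof.
move=> cX; have [||||||||| h hE] := @hom_from_rmod _ (rep_I4 (kres X)) X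
  (id_linear _) (lzero _ _) (lzero _ _) (lzero _ _);
  try by move=> x /=; rewrite ?(conc_ar _ _ cX) ?scaler0 //; apply: cX.
exists h => x; exists (mk4 (V := rep_I4 (kres X)) x 0 0 0).
by rewrite hE /= !addr0.
Qed.

Section LengthTwo.
Hypothesis P3 : forall i, (2 < i)%N -> forall x : P i, x = 0.

Lemma cohomology_top i X : H i.+3 X.
Proof.
move=> f _; exists (zero_linear _ _) => x.
by rewrite (P3 _ x) // linear0.
Qed.

(** Length 2 makes $H^3$ of the kernel vanish. *)
Lemma cohomology2_quotient A X (p : {linear A -> X}) :
  (forall x, exists a, p a = x) -> H 2 A -> H 2 X.
Proof.
move=> surj HA; refine (cohomology_coker (short_exact_ker surj) _ HA).
exact: cohomology_top.
Qed.

Lemma cohomology2_conc1 X : conc v1 X -> H 2 X.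
Proof.
move=> /conc1_I4 [p surj]; refine (cohomology2_quotient surj _).
exact: cohomology_I4.
Qed.

Lemma conc_quot v X (S : submodule X) :
  (forall x, S (x - ev v *: x)) -> conc v (quotmod S).
Proof.
move=> HS z; have [x <-] := quot_proj_surj z; rewrite -linearZ_LR.
by apply/esym/eqP; rewrite -subr_eq0 -linearB; apply/eqP/quot_proj_eq0.
Qed.

Lemma conc_sub v X (S : submodule X) :
  (forall x, S x -> ev v *: x = x) -> conc v (submod S).
Proof.
move=> HS x; apply: submod_incl_inj; rewrite linearZ_LR; apply: HS.
exact: submod_inclP.
Qed.

Lemma ev3_sub_lin X r (x y : X) : ev v3 *: x = 0 -> ev v3 *: y = 0 ->
  ev v3 *: (r *: x + y) = 0.
Proof.
apply: ann_sub_lin => {r x y} [c|v x ex|a x _]; first by rewrite sc_comm.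
  by rewrite evev; case: v => /=; rewrite ?scale0r.
by rewrite evar; case: a => /=; rewrite scale0r.
Qed.
(** Stable because no arrow ends at 3. The quotient is concentrated at 3 and acyclic, which reduces
    later arguments to modules without the vertex 3. *)
Definition ev3_sub X : submodule X :=
  @Submodule _ X (fun x => ev v3 *: x = 0) (scaler0 _ _) (@ev3_sub_lin X).

Lemma ev3_sub_quot X : conc v3 (quotmod (ev3_sub X)).
Proof. by apply: conc_quot => x /=; rewrite scalerBr scalerA evev subrr. Qed.

Definition supp13 (X : lmodType R) :=
  (forall x : X, ev v2 *: x = 0) /\ forall x : X, ev v4 *: x = 0.

Lemma ev3_sub_conc1 X : supp13 X -> conc v1 (submod (ev3_sub X)).
Proof.
move=> [X2 X4]; apply: conc_sub => x /= x3.
by rewrite [RHS]ev_sum X2 X4 x3 !addr0.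
Qed.

Lemma cohomology2_supp13 X : supp13 X -> H 2 X.
Proof.
move=> sX; refine (cohomology_ext (short_exact_quot (ev3_sub X)) _ _).
  exact/cohomology2_conc1/ev3_sub_conc1.
exact/cohomology_conc3/ev3_sub_quot.
Qed.

(** The kernel consists of the coordinates dual to $e_1$ and $\delta$, so its $H^2$ vanishes and
    $H^1(T)$ follows from $H^1(I_1)$. *)
Lemma I1_T V : exists p : {linear rmod (rep_I1 V) -> rmod (rep_T V)},
  (forall x, exists a, p a = x) /\ supp13 (submod (ker_sub p)).
Proof.
have [||||||||| h hE] := @hom_to_rmod _ (rep_T V) (rmod (rep_I1 V))
  (lsnd V \o rc1 (rep_I1 V)) (rc2 (rep_I1 V)) (lsnd V \o rc3 (rep_I1 V)) (lzero _ _);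
  try by move=> x; rewrite ?rmod_ev ?rmod_ar.
exists h; split=> [x|].
  exists (mk4 (V := rep_I1 V) (0, c1 x) (c2 x) (0, c3 x) 0); rewrite hE.
  by apply: rmod_eq => //; rewrite [RHS]kzero_eq.
split=> x; apply: submod_incl_inj; rewrite linearZ_LR linear0 rmod_ev /=.
  have := submod_inclP x; rewrite /= hE => /(congr1 (@c2 _ _)) /= x2.
  by apply: rmod_eq.
by apply: rmod_eq => //; rewrite [LHS]kzero_eq [RHS]kzero_eq.
Qed.

Lemma cohomology1_T V : H 1 (rmod (rep_T V)).
Proof.
have [p [surj kp]] := I1_T V.
refine (cohomology_coker (short_exact_ker surj) _ _); last exact: cohomology_I1.
exact: cohomology2_supp13.
Qed.

Lemma cohomology2_T V : H 2 (rmod (rep_T V)).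
Proof.
have [p [surj _]] := I1_T V; refine (cohomology2_quotient surj _).
exact: cohomology_I1.
Qed.

(** $T$ misses only the coordinate of $I_2$ dual to $\beta$, which gives the simple module at 1 as
    cokernel. *)
Lemma conc1_T_I2 X : conc v1 X ->
  exists (j : {linear rmod (rep_T (kres X)) -> rmod (rep_I2 (kres X))})
         (p : {linear rmod (rep_I2 (kres X)) -> X}), short_exact j p.
Proof.
move=> cX; pose V := kres X; have [||||||||| p pE] := @hom_from_rmod _ (rep_I2 V) X
  (lsnd V) (lzero _ _) (lzero _ _) (lzero _ _);
  try by move=> x /=; rewrite ?(conc_ar _ _ cX) ?scaler0 //; apply: cX.
have [||||||||| j jE] := @hom_to_rmod _ (rep_I2 V) (rmod (rep_T V))
  (lpair (id_linear V) (lzero _ _) \o rc1 (rep_T V)) (rc2 (rep_T V)) (rc3 (rep_T V)) (lzero _ _);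
  try by move=> x; rewrite ?rmod_ev ?rmod_ar.
exists j, p; split=> [x y|x|x].
- rewrite !jE => E; apply: rmod_eq; [|exact: (congr1 (@c2 _ (rep_I2 V)) E)|
    exact: (congr1 (@c3 _ (rep_I2 V)) E)|by rewrite [LHS]kzero_eq [RHS]kzero_eq].
  exact: (congr1 (fun z => (@c1 _ (rep_I2 V) z).1) E).
- exists (mk4 (V := rep_I2 V) (0, x : V) 0 0 0).
  by rewrite pE /= !addr0.
- rewrite pE /= !addr0; split=> [x1|[a <-]]; last by rewrite jE.
  exists (mk4 (V := rep_T V) (c1 x).1 (c2 x) (c3 x) 0); rewrite jE.
  apply: rmod_eq => //; last by rewrite [RHS]kzero_eq.
  by rewrite [RHS]surjective_pairing; congr (_, _); symmetry.
Qed.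

Lemma cohomology1_conc1 X : conc v1 X -> H 1 X.
Proof.
move=> /conc1_T_I2 [j [p jp]]; refine (cohomology_coker jp _ _).
  exact: cohomology2_T.
exact: cohomology_I2.
Qed.

Lemma cohomology1_supp13 X : supp13 X -> H 1 X.
Proof.
move=> sX; refine (cohomology_ext (short_exact_quot (ev3_sub X)) _ _).
  exact/cohomology1_conc1/ev3_sub_conc1.
exact/cohomology_conc3/ev3_sub_quot.
Qed.

(** Such a module is the socle of a sum of copies of $I_2$, and the quotient lives at the vertices 1
    and 3, where $H^1$ is already known to vanish. *)
Lemma cohomology2_conc2 X : conc v2 X -> H 2 X.
Proof.
move=> cX; pose V := kres X.
have [||||||||| j jE] := @hom_to_rmod _ (rep_I2 V) X
  (lzero _ _) (id_linear V) (lzero _ _) (lzero _ _);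
  try by move=> x /=; rewrite ?(conc_ar _ _ cX) // ?linear0 //; apply: cX.
have injj : injective j.
  by move=> x y; rewrite !jE => E; exact: (congr1 (@c2 _ (rep_I2 V)) E).
have jp : short_exact j (quot_proj (im_sub j)).
  split=> [//||x]; first exact: (@quot_proj_surj _ _ (im_sub j)).
  exact: quot_proj_eq0.
refine (cohomology_ker jp _ _); last exact: cohomology_I2.
apply: cohomology1_supp13; split=> z; have [x <-] := quot_proj_surj z;
  rewrite -linearZ_LR; apply/quot_proj_eq0; rewrite rmod_ev /=.
  by exists (c2 x : X); rewrite jE.
exists 0; rewrite linear0; apply: rmod_eq => //.
by rewrite [LHS]kzero_eq [RHS]kzero_eq.
Qed.

Definition supp12 (X : lmodType R) :=
  (forall x : X, ev v3 *: x = 0) /\ forall x : X, ev v4 *: x = 0.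

Lemma supp12_sub X (S : submodule X) : supp12 X -> supp12 (submod S).
Proof.
by move=> [X3 X4]; split=> x; apply: submod_incl_inj; rewrite linearZ_LR linear0 ?X3 ?X4.
Qed.

Lemma supp12_delta X (x : X) : supp12 X -> ar delta *: x = 0.
Proof.
move=> [X3 _]; have -> : ar delta = ar delta * ev v3 by rewrite arev.
by rewrite -scalerA X3 scaler0.
Qed.

Lemma ev2_sub_lin X : (forall x : X, ar alpha *: x = 0) ->
  (forall x : X, ar beta *: x = 0) ->
  forall r (x y : X), ev v2 *: x = 0 -> ev v2 *: y = 0 -> ev v2 *: (r *: x + y) = 0.
Proof.
move=> Xa Xb; apply: ann_sub_lin => [c|v x ex|a x _]; first by rewrite sc_comm.
  by rewrite evev; case: v => /=; rewrite ?scale0r.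
by rewrite evar; case: a => /=; rewrite ?scale0r.
Qed.

Lemma cohomology2_supp12_ab X : supp12 X -> (forall x : X, ar alpha *: x = 0) ->
  (forall x : X, ar beta *: x = 0) -> H 2 X.
Proof.
move=> sX Xa Xb; have [X3 X4] := sX.
pose S := @Submodule _ X (fun x => ev v2 *: x = 0) (scaler0 _ _) (ev2_sub_lin Xa Xb).
refine (cohomology_ext (short_exact_quot S) _ _).
  apply/cohomology2_conc1/conc_sub => x /= x2.
  by rewrite [RHS]ev_sum x2 X3 X4 !addr0.
by apply/cohomology2_conc2/conc_quot => x /=; rewrite scalerBr scalerA evev subrr.
Qed.

(** Since $\alpha\gamma = \beta\gamma = 0$, the common kernel of $\alpha$ and $\beta$ is stable; it
    contains $X_2$, so the quotient is concentrated at 1. *)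
Lemma ab_sub_lin X : supp12 X -> forall r (x y : X),
  ar alpha *: x = 0 /\ ar beta *: x = 0 -> ar alpha *: y = 0 /\ ar beta *: y = 0 ->
  ar alpha *: (r *: x + y) = 0 /\ ar beta *: (r *: x + y) = 0.
Proof.
move=> sX; apply: gamma_sub_lin.
- by rewrite !scaler0.
- by move=> x y [ax bx] [ay bY]; rewrite !scalerDr ax bx ay bY !addr0.
- by move=> c x [ax bx]; rewrite !scalerA -!sc_comm -!scalerA ax bx !scaler0.
- move=> v x [ax bx]; rewrite !scalerA !arev.
  by case: v => /=; rewrite ?ax ?bx ?scale0r.
- move=> a x [ax bx]; case: a; first by rewrite supp12_delta // !scaler0.
  + by rewrite ax !scaler0.
  + by rewrite bx !scaler0.
  + by rewrite !scalerA !arar0 !scale0r.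
  + by rewrite !scalerA !arar0 !scale0r.
Qed.

Lemma cohomology2_supp12 X : supp12 X -> H 2 X.
Proof.
move=> sX; have [X3 X4] := sX.
have S0 : ar alpha *: (0 : X) = 0 /\ ar beta *: (0 : X) = 0 by rewrite !scaler0.
pose S := @Submodule _ X _ S0 (ab_sub_lin sX).
refine (cohomology_ext (short_exact_quot S) _ _).
  apply: cohomology2_supp12_ab => [|x|x]; first exact: supp12_sub.
    apply: submod_incl_inj; rewrite linearZ_LR linear0.
    by have [] := submod_inclP x.
  apply: submod_incl_inj; rewrite linearZ_LR linear0.
  by have [] := submod_inclP x.
by apply/cohomology2_conc1/conc_quot => x /=; rewrite !scalerBr !scalerA !arev !subrr.
Qed.

Lemma cohomology2_ev4 X : (forall x : X, ev v4 *: x = 0) -> H 2 X.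
Proof.
move=> X4; refine (cohomology_ext (short_exact_quot (ev3_sub X)) _ _).
  apply: cohomology2_supp12; split=> x; apply: submod_incl_inj.
    by rewrite linearZ_LR linear0; apply: (submod_inclP x).
  by rewrite linearZ_LR linear0 X4.
exact/cohomology_conc3/ev3_sub_quot.
Qed.

(** The kernel is the coordinate of $\gamma\alpha\delta$ at vertex 1. *)
Lemma P3_T V : exists p : {linear rmod (rep_P3 V) -> rmod (rep_T V)},
  (forall x, exists a, p a = x) /\ conc v1 (submod (ker_sub p)).
Proof.
have [||||||||| h hE] := @hom_to_rmod _ (rep_T V) (rmod (rep_P3 V))
  (lfst V \o rc1 (rep_P3 V)) (rc2 (rep_P3 V)) (rc3 (rep_P3 V)) (lzero _ _);
  try by move=> x; rewrite ?rmod_ev ?rmod_ar.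
exists h; split=> [x|].
  exists (mk4 (V := rep_P3 V) (c1 x, 0) (c2 x) (c3 x) 0); rewrite hE.
  by apply: rmod_eq => //; rewrite [RHS]kzero_eq.
apply: conc_sub => x /=; rewrite hE rmod_ev => E.
apply: rmod_eq => //=; [| |by rewrite [LHS]kzero_eq [RHS]kzero_eq].
  exact/esym/(congr1 (@c2 _ (rep_T V)) E).
exact/esym/(congr1 (@c3 _ (rep_T V)) E).
Qed.

Lemma cohomology1_P3 V : H 1 (rmod (rep_P3 V)).
Proof.
have [p [surj kp]] := P3_T V.
refine (cohomology_ext (short_exact_ker surj) _ _); last exact: cohomology1_T.
exact: cohomology1_conc1.
Qed.

(** The hypothesis on $X_2$ gives stability under $\gamma$, since $\gamma X_2$ lies in
    $\gamma\alpha\delta X$. *)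
Lemma delta_image_lin X r (x y : X) :
  (exists u w, ev v1 *: x = ar delta *: u + (ar gamma * ar alpha * ar delta) *: w) ->
  (exists u w, ev v1 *: y = ar delta *: u + (ar gamma * ar alpha * ar delta) *: w) ->
  (forall x : X, exists z, ev v2 *: x = (ar alpha * ar delta) *: z) ->
  exists u w, ev v1 *: (r *: x + y) = ar delta *: u + (ar gamma * ar alpha * ar delta) *: w.
Proof.
move=> Sx Sy im; move: r x y Sx Sy; apply: gamma_sub_lin.
- by exists 0, 0; rewrite !scaler0 addr0.
- move=> x y [u [w xE]] [u' [w' yE]]; exists (u + u'), (w + w').
  by rewrite scalerDr xE yE !scalerDr addrACA.
- move=> c x [u [w xE]]; exists (sc c *: u), (sc c *: w).
  by rewrite scalerA -sc_comm -scalerA xE scalerDr !scalerA !sc_comm.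
- move=> v x [u [w xE]]; rewrite scalerA evev; case: v => /=; first by exists u, w.
  + by exists 0, 0; rewrite scale0r !scaler0 addr0.
  + by exists 0, 0; rewrite scale0r !scaler0 addr0.
  + by exists 0, 0; rewrite scale0r !scaler0 addr0.
- move=> a x _; rewrite scalerA evar; case: a => /=.
  + by exists x, 0; rewrite scaler0 addr0.
  + by exists 0, 0; rewrite scale0r !scaler0 addr0.
  + by exists 0, 0; rewrite scale0r !scaler0 addr0.
  + have [z zE] := im x; exists 0, z; rewrite scaler0 add0r.
    have -> : ar gamma = ar gamma * ev v2 by rewrite arev.
    by rewrite -scalerA zE scalerA !mulrA arev.
  + by exists 0, 0; rewrite scale0r !scaler0 addr0.
Qed.

(** The submodule [S] keeps all of $X_2$ and $X_3$ but only the part of $X_1$ reached from the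
    vertex 3. It is a quotient of copies of $Re_3$, while [X] modulo [S] is concentrated at 1. *)
Lemma cohomology1_alpha_delta X : (forall x : X, ev v4 *: x = 0) ->
  (forall x : X, exists z, ev v2 *: x = (ar alpha * ar delta) *: z) -> H 1 X.
Proof.
move=> X4 im; pose V := kres X.
have S0 : exists u w : X,
    ev v1 *: (0 : X) = ar delta *: u + (ar gamma * ar alpha * ar delta) *: w.
  by exists 0, 0; rewrite !scaler0 addr0.
pose S := @Submodule _ X _ S0 (fun r x y Sx Sy => @delta_image_lin X r x y Sx Sy im).
refine (cohomology_ext (short_exact_quot S) _ _); last first.
  apply/cohomology1_conc1/conc_quot => x /=; exists 0, 0.
  by rewrite scalerBr scalerA evev subrr !scaler0 addr0.
(* The copies of $Re_3$ are indexed by all of [X]; the element [x] serves through $e_3 x$, because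
   every path used starts at 3. *)
have [||||||||| p pE] := @hom_from_rmod _ (rep_P3 V) X
  ((kact X (ar delta) \o lfst V) \+ (kact X (ar gamma * ar alpha * ar delta) \o lsnd V))
  (kact X (ar alpha * ar delta)) (kact X (ev v3)) (lzero _ _).
- by move=> x /=; rewrite scalerDr !scalerA !mulrA !evar.
- by move=> x /=; rewrite scalerA !mulrA !evar.
- by move=> x /=; rewrite scalerA evev.
- by move=> x /=; rewrite scaler0.
- by move=> x /=; rewrite scalerA arev scaler0 addr0.
- by move=> x /=; rewrite scalerDr !scalerA !mulrA !arar0 !mul0r scale0r addr0.
- by move=> x /=; rewrite scalerDr !scalerA !mulrA !arar0 !mul0r !scale0r !scaler0 addr0.
- by move=> x /=; rewrite scalerA scaler0 add0r mulrA.
- by move=> x /=; rewrite scalerA mulrA rel_ead scale0r.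
have pS y : S (p y).
  rewrite pE /=; exists (c1 y).1, (c1 y).2; rewrite addr0 !scalerDr !scalerA !mulrA.
  by rewrite !evar evev /= !mul0r !scale0r !addr0.
have [q qE] := linear_factor (@submod_incl_inj _ _ S) (fun y => submod_inclS (pS y)).
have qsurj x : exists y, q y = x.
  have [u [w x1]] := submod_inclP x; have [z x2] := im (submod_incl _ x).
  exists (mk4 (V := rep_P3 V) (u : V, w : V) (z : V) (submod_incl _ x : V) 0).
  apply: submod_incl_inj; rewrite qE pE /=.
  by rewrite [RHS]ev_sum X4 -x1 -x2.
refine (cohomology_coker (short_exact_ker qsurj) _ _); last exact: cohomology1_P3.
apply: cohomology2_ev4 => y; apply: submod_incl_inj; rewrite linearZ_LR linear0 rmod_ev.
by apply: rmod_eq => //; rewrite [LHS]kzero_eq [RHS]kzero_eq.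
Qed.

End LengthTwo.
End VanishingCohomology.

(** * Finite type in dimension 2 *)

Section IdempotentComplex.
Variables (R : pzRingType) (e t : nat -> R).
Hypothesis ee : forall i, e i * e i = e i.
Hypothesis te : forall i, t i * e i = t i.
Hypothesis ext : forall i, e i.+1 * t i = t i.
Hypothesis exact_et : forall i r, r * e i.+1 = r ->
  r * t i = 0 <-> exists2 s, s * e i.+2 = s & r = s * t i.+1.

Definition ic_elt i : rid (e i) := sval (cid (rval_mk (te i))).
Lemma rval_ic_elt i : rval (ic_elt i) = t i.
Proof. by rewrite /ic_elt; case: cid. Qed.

(** Right multiplication by [t i], which is a map of left modules. *)
Definition ic_diff i : {linear rid (e i.+1) -> rid (e i)} :=
  sval (cid (rid_map (e i.+1) (ic_elt i))).
Lemma ic_diffE i x : ic_diff i x = rval x *: ic_elt i.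
Proof. by rewrite /ic_diff; case: cid. Qed.
Lemma rval_ic_diff i x : rval (ic_diff i x) = rval x * t i.
Proof. by rewrite ic_diffE rvalZ rval_ic_elt. Qed.

Lemma ic_exact i x : ic_diff i x = 0 <-> exists y, x = ic_diff i.+1 y.
Proof.
have <- : rval x * t i = 0 <-> ic_diff i x = 0.
  by rewrite -rval_ic_diff; split=> [xt|->]; [apply: rval_inj; rewrite xt rval0|rewrite rval0].
rewrite (exact_et (rvalP x)); split=> [[s se xE]|[y ->]].
  have [y yE] := rval_mk se; exists y.
  by apply: rval_inj; rewrite rval_ic_diff yE.
by exists (rval y); [exact: rvalP|rewrite rval_ic_diff].
Qed.

Definition ic_coker : lmodType R := quotmod (im_sub (ic_diff 0)).

Definition ic_resolution : projective_resolution ic_coker :=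
  coker_resolution (fun i => rid_projective (ee i)) ic_exact.

Lemma ic_fg : fg_resolvable ic_coker.
Proof. by exists ic_resolution => i; apply: rid_fg. Qed.

Lemma rid0 (x : rid (0 : R)) : x = 0.
Proof. by apply: rval_inj; rewrite rval0 -(rvalP x) mulr0. Qed.

Lemma ic_pdim n : (forall i, (n < i)%N -> e i = 0) -> pdim_le n ic_coker.
Proof.
move=> e0; exists ic_resolution => i ni x.
apply: rval_inj; rewrite rval0; have := rvalP x; move: (rval x) => r.
by rewrite e0 // mulr0.
Qed.

(** As $\mathrm{Hom}_R(Re, X) = eX$, a cocycle is an element of $e_{i+1}X$ killed by $t_{i+1}$, and
    a coboundary is a multiple of $t_i$. *)
Lemma ic_Ext i (X : lmodType R) (x : X) :
  Ext_zero i.+1 ic_coker X -> e i.+1 *: x = x -> t i.+1 *: x = 0 ->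
  exists z, x = t i *: z.
Proof.
move=> /(_ ic_resolution) /= HX ex tx.
have [f fE] := rid_map (e i.+1) x.
have [|g gE] := HX f; first by move=> y; rewrite fE rval_ic_diff -scalerA tx scaler0.
exists (g (rgen (ee i))); have := gE (rgen (ee i.+1)).
rewrite fE rval_gen ex => ->; rewrite -linearZ_LR; congr (g _); apply: rval_inj.
by rewrite rval_ic_diff rvalZ !rval_gen ext te.
Qed.

End IdempotentComplex.

(** * Vanishing of cohomology on the orthogonal class *)

Section PartOne.
Variable K : fieldType.
Local Notation R := (Gamma_algebra K).
Local Notation sc := (@sc K).
Local Notation ev := (@ev K).
Local Notation ar := (@ar K).

Definition arrow_exact (X : lmodType R) :=
  [/\ forall x : X, exists z, ev v2 *: x = ar alpha *: z,
      forall x : X, exists z, ev v4 *: x = ar epsilon *: z &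
      forall x : X, ar epsilon *: x = 0 -> exists z, ev v2 *: x = (ar alpha * ar delta) *: z].

Lemma ev4_sub_lin (X : lmodType R) c (x y : kres X) :
  ev v4 *: (x : X) = x -> ev v4 *: (y : X) = y ->
  ev v4 *: ((c *: x + y : kres X) : X) = (c *: x + y : kres X).
Proof.
move=> x4 y4; rewrite [LHS](_ : _ = ev v4 *: (sc c *: (x : X) + (y : X))) //.
by rewrite scalerDr y4 scalerA -sc_comm -scalerA x4.
Qed.

Definition ev4_space (X : lmodType R) : submodule (kres X) :=
  @Submodule K (kres X) (fun x => ev v4 *: (x : X) = x) (scaler0 _ _) (@ev4_sub_lin X).

(** The adjoint of the projection $X \to X_4$; it is onto because $\epsilon$ maps $X_2$ onto $X_4$
    and $\alpha$ maps $X_1$ onto $X_2$. *)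
Lemma I4_cover (X : lmodType R) : arrow_exact X ->
  exists p : {linear X -> rmod (rep_I4 (submod (ev4_space X)))},
  (forall y, exists x, p x = y) /\
  forall x, p x = 0 <-> [/\ (ar epsilon * ar alpha) *: x = 0, ar epsilon *: x = 0 & ev v4 *: x = 0].
Proof.
move=> [good2 good4 _]; set V := submod (ev4_space X).
pose incl : {linear V -> kres X} := submod_incl (ev4_space X).
have inclI : injective incl by exact: submod_incl_inj.
have comp r : ev v4 * r = r -> exists f : {linear kres X -> V}, forall x, incl (f x) = r *: (x : X).
  move=> r4; have [x|f fE] := @linear_factor _ _ _ _ incl (kact X r) inclI; last by exists f.
  by apply: submod_inclS; rewrite /= scalerA r4.
have [|f1 f1E] := comp (ar epsilon * ar alpha); first by rewrite mulrA evar.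
have [|f2 f2E] := comp (ar epsilon); first by rewrite evar.
have [|f4 f4E] := comp (ev v4); first by rewrite evev.
have [||||||||| p pE] := @hom_to_rmod _ (rep_I4 V) X f1 f2 (lzero _ _) f4.
- by move=> x; apply: inclI; rewrite !f1E scalerA -mulrA arev.
- by move=> x; apply: inclI; rewrite !f2E scalerA arev.
- by [].
- by move=> x; apply: inclI; rewrite !f4E scalerA evev.
- move=> x; suff -> : f1 (ar delta *: x) = 0 by [].
  by apply: inclI; rewrite f1E linear0 scalerA rel_ead scale0r.
- move=> x; suff -> : f2 (ar alpha *: x) = f1 x by [].
  by apply: inclI; rewrite f1E f2E scalerA.
- move=> x; suff -> : f2 (ar beta *: x) = 0 by [].
  by apply: inclI; rewrite f2E linear0 scalerA !arar0 scale0r.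
- move=> x; suff -> : f1 (ar gamma *: x) = 0 by [].
  by apply: inclI; rewrite f1E linear0 scalerA -mulrA !arar0 mulr0 scale0r.
- move=> x; suff -> : f4 (ar epsilon *: x) = f2 x by [].
  by apply: inclI; rewrite f2E f4E scalerA evar.
exists p; split=> [y|x]; last first.
  rewrite pE; split=> [E|[x1 x2 x4]].
    split; [rewrite -f1E|rewrite -f2E|rewrite -f4E].
    + by rewrite [f1 x](congr1 (@c1 _ (rep_I4 V)) E) linear0.
    + by rewrite [f2 x](congr1 (@c2 _ (rep_I4 V)) E) linear0.
    + by rewrite [f4 x](congr1 (@c4 _ (rep_I4 V)) E) linear0.
  by apply: rmod_eq => //=; apply: inclI; rewrite ?f1E ?f2E ?f4E linear0.
have lift4 (v : V) : exists z : X, incl v = ar epsilon *: z.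
  have [z zE] := good4 (incl v); exists z; rewrite -zE.
  by symmetry; apply: (submod_inclP v).
have [z2 z2E] := lift4 (c2 y).
have [z1' z1E'] := lift4 (c1 y); have [z1 z1E] := good2 z1'.
have y4E : ev v4 *: (incl (c4 y) : X) = incl (c4 y) by exact: (submod_inclP (c4 y)).
(* The idempotents separate the three preimages, so each affects one coordinate only. *)
exists (ev v1 *: z1 + ev v2 *: z2 + ev v4 *: (incl (c4 y) : X)).
rewrite pE; apply: rmod_eq => /=; last first.
- by apply: inclI; rewrite f4E !scalerDr !scalerA !evev /= !scale0r !add0r.
- by rewrite [RHS]kzero_eq.
- by apply: inclI; rewrite f2E !scalerDr !scalerA !arev /= !scale0r addr0 add0r.
- apply: inclI; rewrite f1E !scalerDr !scalerA -!mulrA !arev /= !mulr0 !scale0r !addr0.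
  by rewrite -scalerA -z1E scalerA arev; apply/esym/z1E'.
Qed.

Variables (M : lmodType R) (P : projective_resolution M).
Hypothesis P3 : forall i, (2 < i)%N -> forall x : P i, x = 0.

Lemma arrow_exact_cohomology X i : arrow_exact X -> hom_cohomology_zero P i.+1 X.
Proof.
move=> gX; have [p [surj kp]] := I4_cover gX.
have k4 (y : submod (ker_sub p)) : ev v4 *: y = 0.
  apply: submod_incl_inj; rewrite linearZ_LR linear0.
  by have /kp[] := submod_inclP y.
case: i => [|[|i]]; last exact: cohomology_top.
- refine (cohomology_ext (short_exact_ker surj) _ _); last exact: cohomology_I4.
  apply: cohomology1_alpha_delta => // y.
  have /kp[_ y2 _] := submod_inclP y; have [_ _ /(_ _ y2) [z zE]] := gX.
  (* Only the part of [z] at vertex 3 counts, and it lies in the kernel of [p]. *)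
  have [w wE] : exists w, submod_incl (ker_sub p) w = ev v3 *: z.
    apply: submod_inclS; apply/kp.
    by rewrite !scalerA -mulrA !arev evev /= mulr0 !scale0r.
  exists w; apply: submod_incl_inj; rewrite !linearZ_LR wE zE scalerA.
  by rewrite -mulrA arev.
- refine (cohomology_ext (short_exact_ker surj) _ _); last exact: cohomology_I4.
  exact: cohomology2_ev4.
Qed.

End PartOne.

(** * The two test modules and finite type in dimension 2 *)

Section TestModules.
Variable K : fieldType.
Local Notation R := (Gamma_algebra K).
Local Notation sc := (@sc K).
Local Notation ev := (@ev K).
Local Notation ar := (@ar K).

Lemma sc0 : sc 0 = 0.
Proof. by apply: (addrI (sc 0)); rewrite -scD !addr0. Qed.

(** Every arrow kills $\gamma$ and $\epsilon$ from the left, so $e_2$, $\gamma$, $\epsilon$ span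
    $Re_2$. *)
Lemma column2 (r : R) : exists a b c,
  r * ev v2 = sc a * ev v2 + sc b * ar gamma + sc c * ar epsilon.
Proof.
elim/R_ind: r => [|r s [a [b [c rE]]] [a' [b' [c' sE]]]|c v|x r [a [b [c rE]]]].
- by exists 0, 0, 0; rewrite sc0 !mul0r !addr0.
- exists (a + a'), (b + b'), (c + c'); rewrite !scD !mulrDl rE sE addrACA; congr (_ + _).
  by rewrite addrACA.
- rewrite -mulrA evev; case: v => /=; try by exists 0, 0, 0; rewrite sc0 mulr0 !mul0r !addr0.
  by exists c, 0, 0; rewrite sc0 !mul0r !addr0.
- rewrite -mulrA rE !mulrDr !mulrA -!sc_comm -!mulrA arev.
  case: x => /=; rewrite ?arar0 ?mulr0 ?addr0.
  + by exists 0, 0, 0; rewrite sc0 !mul0r !addr0.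
  + by exists 0, 0, 0; rewrite sc0 !mul0r !addr0.
  + by exists 0, 0, 0; rewrite sc0 !mul0r !addr0.
  + by exists 0, a, 0; rewrite sc0 !mul0r addr0 add0r.
  + by exists 0, 0, a; rewrite sc0 !mul0r !add0r.
Qed.

Lemma column4 (r : R) : exists a, r * ev v4 = sc a * ev v4.
Proof.
elim/R_ind: r => [|r s [a rE] [a' sE]|c v|x r [a rE]].
- by exists 0; rewrite sc0 !mul0r.
- by exists (a + a'); rewrite scD !mulrDl rE sE.
- rewrite -mulrA evev; case: v => /=; try by exists 0; rewrite sc0 mulr0 !mul0r.
  by exists c.
- rewrite -mulrA rE mulrA -sc_comm -mulrA arev.
  by case: x => /=; exists 0; rewrite sc0 !mulr0 mul0r.
Qed.

(* R e_1 / R beta. *)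
Definition rep_P1 : rep K.
Proof.
by apply: (@Rep K (K^o * K^o)%type K^o (kzero K) K^o (lzero _ _) (lfst _) (lzero _ _)
  (lpair (lzero _ _) (id_linear _)) (id_linear _)) => x //=; rewrite ?linear0.
Defined.

(** The element is tested on the generator of $Re_1/R\beta$, where $\alpha$, $\gamma\alpha$ and
    $\epsilon\alpha$ stay linearly independent. *)
Lemma alpha_reg (r : R) : r * ev v2 = r -> r * ar alpha = 0 -> r = 0.
Proof.
move=> r2 ra; have [a [b [c]]] := column2 r; rewrite r2 => rE.
have : r *: (ar alpha *: (mk4 (V := rep_P1) (1, 0) 0 0 0 : rmod rep_P1)) = 0.
  by rewrite scalerA ra scale0r.
rewrite rE !scalerDl -!scalerA !rmod_ar !rmod_ev !rmod_sc /= => E.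
have a0 : a * 1 + b * 0 + c * 0 = 0 := congr1 (@c2 _ rep_P1) E.
have b0 : a * 0 + b * 1 + c * 0 = 0 := congr1 (fun z => (@c1 _ rep_P1 z).2) E.
have c0 : a * 0 + b * 0 + c * 1 = 0 := congr1 (@c4 _ rep_P1) E.
rewrite !mulr0 mulr1 !addr0 in a0; rewrite !mulr0 mulr1 addr0 add0r in b0.
rewrite !mulr0 mulr1 !add0r in c0.
by rewrite a0 b0 c0 sc0 !mul0r !addr0.
Qed.

Lemma epsilon_reg (r : R) : r * ev v4 = r -> r * ar epsilon = 0 -> r = 0.
Proof.
move=> r4 re; have [a] := column4 r; rewrite r4 => rE.
have : r *: (ar epsilon *: (mk4 (V := rep_P1) 0 1 0 0 : rmod rep_P1)) = 0.
  by rewrite scalerA re scale0r.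
rewrite rE -!scalerA !rmod_ar !rmod_ev !rmod_sc /= => E.
have a0 : a * 1 = 0 := congr1 (@c4 _ rep_P1) E.
by rewrite mulr1 in a0; rewrite a0 sc0 mul0r.
Qed.

(** Testing on the generator of $Re_3$ detects the coefficients of $e_2$ and $\gamma$, leaving a
    multiple of $\epsilon$. *)
Lemma alpha_delta_ker (r : R) : r * ev v2 = r ->
  r * (ar alpha * ar delta) = 0 <-> exists2 s, s * ev v4 = s & r = s * ar epsilon.
Proof.
move=> r2; split=> [ra|[s _ ->]]; last by rewrite mulrA -(mulrA s) -mulrA rel_ead mulr0.
have [a [b [c]]] := column2 r; rewrite r2 => rE.
have : r *: ((ar alpha * ar delta) *: (mk4 (V := rep_P3 K^o) 0 0 1 0 : rmod (rep_P3 K^o))) = 0.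
  by rewrite scalerA ra scale0r.
rewrite rE !scalerDl -!scalerA !rmod_ar !rmod_ev !rmod_sc /= => E.
have a0 : a * 1 + b * 0 + c * 0 = 0 := congr1 (@c2 _ (rep_P3 K^o)) E.
have b0 : a * 0 + b * 1 + c * 0 = 0 := congr1 (fun z => (@c1 _ (rep_P3 K^o) z).2) E.
rewrite !mulr0 mulr1 !addr0 in a0; rewrite !mulr0 mulr1 addr0 add0r in b0.
exists (sc c * ev v4); first by rewrite -mulrA evev.
by rewrite a0 b0 sc0 !mul0r !add0r -mulrA evar.
Qed.

(** Data of the resolution $0 \to Re_4 \to Re_2 \to Re_3$; the idempotent 0 yields zero modules in
    higher degrees. Likewise [idemB] and [stepB] encode $0 \to Re_2 \to Re_1$. *)
Definition idemA (i : nat) : R :=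
  match i with 0 => ev v3 | 1 => ev v2 | 2 => ev v4 | _ => 0 end.
Definition stepA (i : nat) : R :=
  match i with 0 => ar alpha * ar delta | 1 => ar epsilon | _ => 0 end.
Definition idemB (i : nat) : R :=
  match i with 0 => ev v1 | 1 => ev v2 | _ => 0 end.
Definition stepB (i : nat) : R := if i is 0 then ar alpha else 0.

Lemma idemA_idem i : idemA i * idemA i = idemA i.
Proof. by case: i => [|[|[|i]]] /=; rewrite ?evev ?mulr0. Qed.
Lemma idemB_idem i : idemB i * idemB i = idemB i.
Proof. by case: i => [|[|i]] /=; rewrite ?evev ?mulr0. Qed.
Lemma stepA_idemA i : stepA i * idemA i = stepA i.
Proof. by case: i => [|[|i]] /=; rewrite -?mulrA ?arev ?mul0r. Qed.
Lemma stepB_idemB i : stepB i * idemB i = stepB i.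
Proof. by case: i => [|i] /=; rewrite ?arev ?mul0r. Qed.
Lemma idemA_stepA i : idemA i.+1 * stepA i = stepA i.
Proof. by case: i => [|[|i]] /=; rewrite ?mulrA ?evar ?mulr0. Qed.
Lemma idemB_stepB i : idemB i.+1 * stepB i = stepB i.
Proof. by case: i => [|i] /=; rewrite ?evar ?mulr0. Qed.

Lemma exactA i r : r * idemA i.+1 = r ->
  r * stepA i = 0 <-> exists2 s, s * idemA i.+2 = s & r = s * stepA i.+1.
Proof.
case: i => [|[|i]] /=; first exact: alpha_delta_ker.
  move=> r4; split=> [/epsilon_reg ->//|[s _ ->]]; last by rewrite mulr0 mul0r.
  by exists 0; rewrite mulr0.
by rewrite !mulr0 => <-; split=> // _; exists 0; rewrite ?mulr0.
Qed.

Lemma exactB i r : r * idemB i.+1 = r ->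
  r * stepB i = 0 <-> exists2 s, s * idemB i.+2 = s & r = s * stepB i.+1.
Proof.
case: i => [|i] /=; last first.
  by rewrite !mulr0 => <-; split=> // _; exists 0; rewrite ?mulr0.
move=> r2; split=> [/alpha_reg ->//|[s _ ->]]; last by rewrite mulr0 mul0r.
by exists 0; rewrite mulr0.
Qed.

Definition modA : lmodType R := ic_coker stepA_idemA.
Definition modB : lmodType R := ic_coker stepB_idemB.

Lemma perp_arrow_exact (X : lmodType R) :
  right_perp (fun N => N = modA \/ N = modB) X -> arrow_exact X.
Proof.
move=> HX; have HA i := HX modA (or_introl erefl) i.+1 isT.
have HB i := HX modB (or_intror erefl) i.+1 isT.
split=> x.
- have [||z zE] := ic_Ext idemB_idem idemB_stepB exactB (x := ev v2 *: x) (HB 0%N).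
  + by rewrite /= scalerA evev.
  + by rewrite /= scale0r.
  + by exists z.
- have [||z zE] := ic_Ext idemA_idem idemA_stepA exactA (x := ev v4 *: x) (HA 1%N).
  + by rewrite /= scalerA evev.
  + by rewrite /= scale0r.
  + by exists z.
- move=> ex; have [||z zE] := ic_Ext idemA_idem idemA_stepA exactA (x := ev v2 *: x) (HA 0%N).
  + by rewrite /= scalerA evev.
  + by rewrite /= scalerA arev.
  + by exists z.
Qed.

(** Both test modules have projective dimension at most 2, which gives one inclusion; the other
    passes through [arrow_exact]. *)
Lemma P2_finite_type : of_finite_type (@pdim_le R 2, right_perp (@pdim_le R 2)).
Proof.
exists (fun N => N = modA \/ N = modB); split=> [N [] ->|X /=].
- exact: (ic_fg idemA_idem stepA_idemA exactA).
- exact: (ic_fg idemB_idem stepB_idemB exactB).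
split=> [/perp_arrow_exact gX M [P P3] [//|i] _|HX N HN i i1].
  by apply: (cohomology_Ext (P := P)) => //; apply: arrow_exact_cohomology.
apply: HX => //; case: HN => ->.
  by apply: (ic_pdim idemA_idem stepA_idemA exactA) => -[|[|[]]].
by apply: (ic_pdim idemB_idem stepB_idemB exactB) => -[|[|[]]].
Qed.

End TestModules.

(** * Failure in dimension 1 *)

Section PartTwo.
Variable K : fieldType.
Local Notation R := (Gamma_algebra K).
Local Notation sc := (@sc K).
Local Notation ev := (@ev K).
Local Notation ar := (@ar K).

(** Coefficient sequences of $K[[N]]$, with [shift] the multiplication by $N$. *)
Definition pseries : lmodType K := nat -> K^o.

Definition shift (f : pseries) : pseries := fun i => if i is j.+1 then f j else 0.
Lemma shift_linear : linear shift.
Proof.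
move=> c f g; apply/funext => -[|i] //=.
by rewrite [RHS](_ : _ = c *: (0 : K^o) + 0) // scaler0 addr0.
Qed.
Definition lshift : {linear pseries -> pseries} := to_linear shift_linear.

Lemma shift0 : shift 0 = 0.
Proof. exact: (linear0 lshift). Qed.

Definition rep_Xhat : rep K.
Proof.
by apply: (@Rep K pseries pseries (kzero K) (kzero K) (lzero _ _) (id_linear _)
  lshift (lzero _ _) (lzero _ _)) => x //=; rewrite ?shift0.
Defined.

Definition rep_E : rep K.
Proof.
by apply: (@Rep K K^o K^o (kzero K) (kzero K) (lzero _ _) (id_linear _)
  (lzero _ _) (lzero _ _) (lzero _ _)) => x //=.
Defined.

Definition Xhat : lmodType R := rmod rep_Xhat.

Lemma I4_E : exists p : {linear rmod (rep_I4 K^o) -> rmod rep_E},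
  forall x, exists a, p a = x.
Proof.
have [||||||||| h hE] := @hom_to_rmod _ rep_E (rmod (rep_I4 K^o))
  (rc1 (rep_I4 K^o)) (rc2 (rep_I4 K^o)) (lzero _ _) (lzero _ _);
  try by move=> x; rewrite ?rmod_ev ?rmod_ar.
exists h => x; exists (mk4 (V := rep_I4 K^o) (c1 x) (c2 x) 0 0); rewrite hE.
by apply: rmod_eq => //; rewrite [RHS]kzero_eq.
Qed.

Definition term0 (f : pseries) : K^o := f 0%N.
Lemma term0_linear : linear term0. Proof. by []. Qed.

(** Multiplication by $N$ is injective on $\hat X$, and on its cokernel $\beta$ becomes 0; this is
    [rep_E]. *)
Lemma Xhat_ses : exists (j : {linear Xhat -> Xhat}) (p : {linear Xhat -> rmod rep_E}),
  short_exact j p /\ (forall x, c1 (j x) = shift (c1 x) /\ c2 (j x) = shift (c2 x)).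
Proof.
have [||||||||| j jE] := @hom_to_rmod _ rep_Xhat Xhat
  (lshift \o rc1 rep_Xhat) (lshift \o rc2 rep_Xhat) (lzero _ _) (lzero _ _);
  try by move=> x; rewrite ?rmod_ev ?rmod_ar //= ?shift0.
have [||||||||| p pE] := @hom_to_rmod _ rep_E Xhat
  (to_linear term0_linear \o rc1 rep_Xhat) (to_linear term0_linear \o rc2 rep_Xhat)
  (lzero _ _) (lzero _ _);
  try by move=> x; rewrite ?rmod_ev ?rmod_ar.
have shiftI : injective shift.
  by move=> f g E; apply/funext => i; have := congr1 (fun f : pseries => f i.+1) E.
have shift_im (f : pseries) : f 0%N = 0 -> shift (fun i => f i.+1) = f.
  by move=> f0; apply/funext => -[|i] //=.
exists j, p; split=> [|x]; last by rewrite jE.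
split=> [x y|x|x].
- rewrite !jE => E; apply: rmod_eq.
  + exact: shiftI (congr1 (@c1 _ rep_Xhat) E).
  + exact: shiftI (congr1 (@c2 _ rep_Xhat) E).
  + by rewrite [LHS]kzero_eq [RHS]kzero_eq.
  + by rewrite [LHS]kzero_eq [RHS]kzero_eq.
- exists (mk4 (V := rep_Xhat) (fun=> c1 x) (fun=> c2 x) 0 0); rewrite pE.
  by apply: rmod_eq => //; rewrite [RHS]kzero_eq.
- rewrite pE; split=> [E|[a <-]]; last by rewrite jE.
  exists (mk4 (V := rep_Xhat) (fun i => c1 x i.+1) (fun i => c2 x i.+1) 0 0); rewrite jE.
  apply: rmod_eq; try by rewrite [LHS]kzero_eq [RHS]kzero_eq.
    exact: shift_im (congr1 (@c1 _ rep_E) E).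
  exact: shift_im (congr1 (@c2 _ rep_E) E).
Qed.

Section LengthOne.
Variables (M : lmodType R) (P : projective_resolution M).
Hypothesis P2 : forall i, (1 < i)%N -> forall x : P i, x = 0.
Local Notation H := (hom_cohomology_zero P).

Lemma cohomology_top1 i X : H i.+2 X.
Proof.
move=> f _; exists (zero_linear _ _) => x.
by rewrite (P2 _ x) // linear0.
Qed.

Lemma cohomology1_E : H 1 (rmod rep_E).
Proof.
have [p surj] := I4_E.
refine (cohomology_coker (short_exact_ker surj) _ _); last exact: cohomology_I4.
exact: cohomology_top1.
Qed.

Section Coordinate.
(* [c] is [c1] or [c2]. *)
Variable c : {linear kres Xhat -> pseries}.
Variable G : nat -> {linear P 0 -> Xhat}.

(** The coefficients of $\sum_k N^k c(G_k(x))$; each of them is a finite sum. *)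
Definition conv (x : P 0) : pseries := fun i => \sum_(k < i.+1) c (G k x) (i - k)%N.

Lemma conv_linear : linear (conv : kres (P 0) -> pseries).
Proof.
move=> a x y; apply/funext => i; rewrite /conv.
rewrite [RHS](_ : _ = a *: conv x i + conv y i) // /conv scaler_sumr -big_split.
by apply: eq_bigr => k _ /=; rewrite -[G k _]/(kmap (G k) _) !linearP.
Qed.

(** Iteration gives $F_0 = \sum_{k<m} N^k G_k d + N^m F_m$, and a fixed coefficient does not see the
    remainder for large $m$. *)
Lemma conv_decomp (j : Xhat -> Xhat) (F : nat -> {linear P 1 -> Xhat}) :
  (forall x, c (j x) = shift (c x)) -> 
  (forall n x, F n x = G n (res_diff P 0 x) + j (F n.+1 x)) ->
  forall x, c (F 0%N x) = conv (res_diff P 0 x).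
Proof.
move=> cj FE x; apply/funext => i; rewrite /conv; set y := res_diff P 0 x.
suff -> n : c (F n x) i = \sum_(k < i.+1) c (G (n + k)%N y) (i - k)%N by [].
have cFE m : c (F m x) = c (G m y) + shift (c (F m.+1 x)).
  by rewrite FE -cj; apply: (linearD c).
elim: i n => [|i IHi] n; rewrite cFE.
  by rewrite big_ord1 addn0 [LHS]addr0.
rewrite big_ord_recl /= addn0; congr (_ + _).
rewrite [LHS]/= IHi; apply: eq_bigr => k _.
by rewrite addnS.
Qed.

End Coordinate.

(** Successive approximation: modulo $N$ a map bounds because $H^1(E) = 0$, and the error is
    divisible by $N$, so the quotient can be treated again. The corrections are summed by [conv]. *)
Lemma cohomology1_Xhat : H 1 Xhat.
Proof.
have [j [p [jp jc]]] := Xhat_ses; have [jinj psurj kerp] := jp.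
move=> f _; have HE : H 1 (rmod rep_E) by exact: cohomology1_E.
have /choice[step stepE] (h : {linear P 1 -> Xhat}) :
    exists gh : {linear P 0 -> Xhat} * {linear P 1 -> Xhat},
    forall x, h x = gh.1 (res_diff P 0 x) + j (gh.2 x).
  (* Every map out of [P 1] is a cocycle because [P 2] is zero. *)
  have [x|q qE] := HE (p \o h); first by rewrite (P2 _ x) // !linear0.
  have [g gE] := @res_projective _ _ P 0 _ _ _ q psurj.
  have [x|k kE] := linear_factor (f := h \- (g \o res_diff P 0)) jinj.
    by apply/kerp => /=; rewrite linearB -[p (h x)]/((p \o h) x) qE gE subrr.
  by exists (g, k) => x; rewrite kE /= addrC subrK.
pose F n := iter n (fun h => (step h).2) f.
pose G n := (step (F n)).1.
have FE n x : F n x = G n (res_diff P 0 x) + j (F n.+1 x) by exact: stepE.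
have l1 := @conv_linear (rc1 rep_Xhat) G.
have l2 := @conv_linear (rc2 rep_Xhat) G.
have [||||||||| h hE] := @hom_to_rmod _ rep_Xhat (P 0) (to_linear l1) (to_linear l2)
  (lzero _ _) (lzero _ _).
- move=> x /=; apply/funext => i; apply: eq_bigr => k _.
  by rewrite linearZ_LR rmod_ev.
- move=> x /=; apply/funext => i; apply: eq_bigr => k _.
  by rewrite linearZ_LR rmod_ev.
- by [].
- by [].
- move=> x; apply/funext => i; symmetry; apply: big1 => k _.
  by rewrite linearZ_LR rmod_ar.
- move=> x /=; apply/funext => i; apply: eq_bigr => k _.
  by rewrite linearZ_LR rmod_ar.
- move=> x /=; apply/funext => -[|i]; rewrite /conv /=.
    by rewrite big_ord1 linearZ_LR rmod_ar.
  (* The top term [k = i.+1] is the constant coefficient of a shifted series, hence 0. *)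
  rewrite [RHS]big_ord_recr /= subnn linearZ_LR rmod_ar /= addr0.
  apply: eq_bigr => k _; rewrite linearZ_LR rmod_ar /=.
  by rewrite subSn // -ltnS.
- move=> x; apply/funext => i; symmetry; apply: big1 => k _.
  by rewrite linearZ_LR rmod_ar.
- by [].
exists h => x; rewrite hE; apply: rmod_eq; last first.
- by rewrite [LHS]kzero_eq [RHS]kzero_eq.
- by rewrite [LHS]kzero_eq [RHS]kzero_eq.
- exact: (@conv_decomp (rc2 rep_Xhat) G j F (fun y => proj2 (jc y)) FE x).
- exact: (@conv_decomp (rc1 rep_Xhat) G j F (fun y => proj1 (jc y)) FE x).
Qed.

End LengthOne.

Lemma Xhat_perp : right_perp (@pdim_le R 1) Xhat.
Proof.
move=> M [P P2] [//|i] _; apply: (cohomology_Ext (P := P)) => //.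
by case: i => [|i]; [apply: cohomology1_Xhat|apply: cohomology_top1].
Qed.

End PartTwo.

(** * A module of projective dimension 1 that detects the direct sum *)

Section InfiniteString.
Variable K : fieldType.
Local Notation R := (Gamma_algebra K).
Local Notation sc := (@sc K).
Local Notation ev := (@ev K).
Local Notation ar := (@ar K).
Local Notation Xhat := (Xhat K).

(* The resolution of the module with generators x_0, x_1, ... at vertex 1 and
   relations alpha x_k + beta x_(k+1) = 0. *)
Definition string_obj (i : nat) : lmodType R := dsum (rid (idemB K i)).

Definition stepC (i : nat) : R := if i is 0 then ar beta else 0.

Lemma stepC_idemB i : stepC i * idemB K i = stepC i.
Proof. by case: i => [|i] /=; rewrite ?arev ?mul0r. Qed.

(** In degree 0 the [k]-th relation goes to $\alpha x_k + \beta x_{k+1}$, so coordinate [k] collects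
    $\alpha$ from relation [k] and $\beta$ from relation [k - 1]. *)
Definition string_fun i (x : string_obj i.+1) (k : nat) : R :=
  rval (dcoord x k) * stepB K i +
  (if k is l.+1 then rval (dcoord x l) * stepC i else 0).

Lemma string_diff_exists i : exists d : {linear string_obj i.+1 -> string_obj i},
  forall x k, rval (dcoord (d x) k) = string_fun x k.
Proof.
have H (x : string_obj i.+1) : exists y : string_obj i, forall k, rval (dcoord y k) = string_fun x k.
  have /choice[g gE] k : exists y : rid (idemB K i), rval y = string_fun x k.
    apply: rval_mk; rewrite /string_fun; case: k => [|k].
      by rewrite !addr0 -mulrA stepB_idemB.
    by rewrite mulrDl -!mulrA stepB_idemB stepC_idemB.
  have [|y yE] := @dsum_mk _ _ g; last by exists y => k; rewrite yE.
  (* The $\beta$ term moves the support up by one. *)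
  have [n xn] := dcoordP x; exists n.+1 => k nk; apply: rval_inj.
  case: k nk => // k nk; rewrite gE /string_fun !xn ?rval0 ?mul0r ?addr0 //.
  exact: ltnW.
have /choice[d dE] := H.
have [d' d'E] : exists d' : {linear string_obj i.+1 -> string_obj i}, d' =1 d.
  apply: linear_exists => a x y; apply: dcoord_inj => k; apply: rval_inj.
  rewrite dcoord_lin rval_lin !dE /string_fun; case: k => [|k].
    by rewrite dcoord_lin rval_lin !addr0 mulrDl mulrA.
  by rewrite !dcoord_lin !rval_lin !mulrDl !mulrDr !mulrA addrACA.
by exists d' => x k; rewrite d'E dE.
Qed.

Definition string_diff i : {linear string_obj i.+1 -> string_obj i} :=
  sval (cid (string_diff_exists i)).
Lemma string_diffE i x k : rval (dcoord (string_diff i x) k) = string_fun x k.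
Proof. by rewrite /string_diff; case: cid. Qed.

Lemma string_obj0 i (x : string_obj i.+2) : x = 0.
Proof. by apply: dcoord_inj => k; rewrite dcoord0; apply: rid0. Qed.

(** The system is triangular with $\alpha$ on the diagonal, and right multiplication by $\alpha$ is
    injective on $Re_2$, so the coordinates vanish one after another. *)
Lemma string_exact i x : string_diff i x = 0 <-> exists y, x = string_diff i.+1 y.
Proof.
case: i x => [|i] x; last first.
  by rewrite (string_obj0 x); split=> [_|_]; rewrite ?linear0 //; exists 0; rewrite linear0.
split=> [dx|[y ->]]; last by rewrite (string_obj0 y) !linear0.
exists 0; rewrite linear0; apply: dcoord_inj => k; rewrite dcoord0; apply: rval_inj.
have dxk l : string_fun x l = 0 by rewrite -string_diffE dx dcoord0 rval0.
have reg l : rval (dcoord x l) * ar alpha = 0 -> rval (dcoord x l) = 0.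
  by apply: alpha_reg; apply: (rvalP (dcoord x l)).
rewrite rval0; elim: k => [|k IHk]; apply: reg.
  by have := dxk 0%N; rewrite /string_fun /= addr0.
by have := dxk k.+1; rewrite /string_fun /= IHk mul0r addr0.
Qed.

Lemma string_projective i : projective (string_obj i).
Proof. apply: dsum_projective; exact: rid_projective (@idemB_idem K i). Qed.

Definition string_module : lmodType R := quotmod (im_sub (string_diff 0)).
Definition string_resolution : projective_resolution string_module :=
  coker_resolution string_projective string_exact.

Lemma string_pdim : pdim_le 1 string_module.
Proof. by exists string_resolution => -[|[|i]] // _ x; apply: string_obj0. Qed.

Definition delta0 : pseries K := fun i => if i is 0 then 1 else 0.

(* In the k-th copy of Xhat the coefficients of a solution x of the equations
   alpha x_k + beta x_(k+1) = (1 in the k-th copy) satisfy x_0 = +-N^k, for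
   every k, so x_0 has infinite support. *)
Lemma string_Ext : ~ Ext_zero 1 string_module (dsum Xhat).
Proof.
move=> /(_ string_resolution) /= HX.
pose y k : dsum Xhat := dinj Xhat k (mk4 (V := rep_Xhat K) 0 delta0 0 0 : Xhat).
have /choice[h hE] (k : nat) : exists f : {linear rid (idemB K 1) -> dsum Xhat},
    forall x, f x = rval x *: y k by apply: rid_map.
have [f fE] := dsum_lift h.
have [|g gE] := HX f.
  by move=> x; rewrite (string_obj0 x) !linear0.
pose g1 : rid (idemB K 0) := rgen (idemB_idem K 0).
pose g2 : rid (idemB K 1) := rgen (idemB_idem K 1).
pose x k := g (dinj _ k g1).
have eqn k : y k = ar alpha *: x k + ar beta *: x k.+1.
  have -> : y k = f (dinj _ k g2).
    rewrite fE hE rval_gen /= -linearZ_LR rmod_ev /y; congr (dinj _ _ _).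
  rewrite gE /x -!linearZ_LR -linearD; congr (g _).
  apply: dcoord_inj => l; apply: rval_inj; rewrite string_diffE /string_fun.
  have dD (u v : string_obj 0) : dcoord (u + v) l = dcoord u l + dcoord v l.
    by have := dcoord_lin l 1 u v; rewrite !scale1r.
  have rD (u v : rid (idemB K 0)) : rval (u + v) = rval u + rval v.
    by have := rval_lin 1 u v; rewrite scale1r mul1r.
  rewrite dD rD !dcoord_dinj.
  case: l {dD} => [|l]; rewrite ?dcoord_dinj ?eqSS.
    by case: eqP => _; rewrite ?rval0 ?rvalZ ?rval_gen /= ?mul0r ?arev ?evar.
  by congr (_ + _); case: eqP => _; rewrite ?rval0 ?rvalZ ?rval_gen /= ?mul0r ?arev ?evar.
pose u k m := c1 (dcoord (x k) m : Xhat).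
(* The equation is read at vertex 2 of copy [m], where $\alpha$ is the identity and $\beta$ the
   shift. *)
have uE k m i : (if k == m then delta0 i else 0) = u k m i + shift (u k.+1 m) i.
  have := congr1 (fun z => c2 (dcoord z m : Xhat) i) (eqn k).
  rewrite dcoord_dinj.
  have -> : dcoord (ar alpha *: x k + ar beta *: x k.+1) m =
     ar alpha *: dcoord (x k) m + ar beta *: dcoord (x k.+1) m.
    by rewrite dcoord_lin dcoordZ.
  rewrite !rmod_ar eq_sym.
  move=> E; transitivity (c2 (if k == m then mk4 (V := rep_Xhat K) 0 delta0 0 0 : Xhat else 0) i).
    by case: eqP.
  rewrite E.
  by rewrite [LHS](_ : _ = u k m i + shift (u k.+1 m) i).
have um m : u m m 0%N = 1 by have := uE m m 0%N; rewrite eqxx /= addr0.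
(* For [k < m] the left side of [uE] is 0, so $u_k = -N u_{k+1}$ in copy [m]. Descending from the
   constant coefficient 1 at [k = m] to [k = 0] shows that $x_0$ is nonzero in every copy. *)
have u0 m l : (l <= m)%N -> u (m - l)%N m l != 0.
  elim: l => [|l IHl] lm; first by rewrite subn0 um oner_eq0.
  have := uE (m - l.+1)%N m l.+1; rewrite -subSn // subSS /=.
  rewrite ltn_eqF; last by rewrite ltn_subrL (leq_trans _ lm).
  move/eqP; rewrite eq_sym addr_eq0 => /eqP ->; rewrite oppr_eq0.
  by apply: IHl; apply: ltnW.
have [n xn] := dcoordP (x 0%N).
by have := u0 n n (leqnn n); rewrite subnn /u xn // eqxx.
Qed.

Lemma P1_not_finite_type : ~ of_finite_type (@pdim_le R 1, right_perp (@pdim_le R 1)).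
Proof.
move=> [S [fgS HS]]; apply: string_Ext.
have SX : right_perp S Xhat by apply/HS; apply: Xhat_perp.
suff /HS /(_ _ string_pdim 1%N isT) : right_perp S (dsum Xhat) by [].
move=> M SM [//|i] _; have [P fgP] := fgS M SM.
apply: (cohomology_Ext (P := P)) => //; apply: cohomology_dsum => //.
exact: (SX M SM i.+1 isT P).
Qed.

End InfiniteString.

Theorem proposition9p13 (K : fieldType) :
  let R := Gamma_algebra K in
  of_finite_type (@pdim_le R 2, right_perp (@pdim_le R 2)) /\
  ~ of_finite_type (@pdim_le R 1, right_perp (@pdim_le R 1)).
Proof. by split; [apply: P2_finite_type|apply: P1_not_finite_type]. Qed.
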